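(* Let $Q$ be a quiver with involution $\sigma$, duality structure and $\sigma$-compatible stability $\theta$, and let $e\in\Lambda_Q^{\sigma,+}$. For each $(d^\bullet,e^\infty)\in\mathsf{HN}^\sigma(e)$ we have \[\overline{R_{d^\bullet,e^\infty}^{\sigma,HN}}\subset\bigcup_{\substack{(d'^\bullet,e'^\infty)\in\mathsf{HN}^\sigma(e)\\(d^\bullet,e^\infty)\le(d'^\bullet,e'^\infty)}}R_{d'^\bullet,e'^\infty}^{\sigma,HN},\] where the closure is taken in $R_e^\sigma$.
   Context: All schemes are over $\mathbb{C}$. Quivers with involution. $Q=(Q_0,Q_1)$ is a finite quiver, $\Lambda_Q=\mathbb{Z}Q_0$, $\Lambda_Q^+=\mathbb{Z}_{\ge 0}Q_0$, and $\dim d=\sum_i d_i$. For $d\in\Lambda_Q^+$, $R_d=\bigoplus_{\alpha:i\to j}\mathrm{Hom}(\mathbb{C}^{d_i},\mathbb{C}^{d_j})$. An involution $\sigma$ of $Q$ is a pair of involutions of $Q_0$ and $Q_1$ such that $\alpha:i\to j$ implies $\sigma(\alpha):\sigma(j)\to\sigma(i)$, and $\sigma(\alpha)=\alpha$ for every arrow $\alpha:i\to\sigma(i)$. A duality structure is a pair $s:Q_0\to\{\pm1\}$, $\tau:Q_1\to\{\pm1\}$ with $s$ $\sigma$-invariant and $\tau_\alpha\tau_{\sigma(\alpha)}=s_is_j$ for each $\alpha:i\to j$. A self-dual representation is a representation $(M,m)$ with a nondegenerate bilinear form $\langle\cdot,\cdot\rangle$ such that $M_i\perp M_j$ unless $i=\sigma(j)$;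 $\langle x,x'\rangle=s_i\langle x',x\rangle$ on $M_i+M_{\sigma(i)}$; and $\langle m_\alpha x,x'\rangle=\tau_\alpha\langle x,m_{\sigma(\alpha)}x'\rangle$ for $\alpha:i\to j$, $x\in M_i$, $x'\in M_{\sigma(j)}$. $\Lambda_Q^{\sigma,+}$ is the set of $\sigma$-fixed elements $e$ of $\Lambda_Q^+$; it is assumed throughout that $e_i$ is even whenever $\sigma(i)=i$ and $s_i=-1$. Then $\mathbb{C}^e$ with zero maps has a self-dual structure, unique up to isometry; $R_e^\sigma\subset R_e$ is the linear subspace of structure maps making $\mathbb{C}^e$ self-dual. If $U\subset M$ is an isotropic subrepresentation, $M/\!\!/U:=U^\perp/U$ with its induced self-dual structure. Stability. A stability is $\theta\in\mathrm{Hom}_{\mathbb{Z}}(\Lambda_Q,\mathbb{Z})$, with slopes $\mu(d)=\theta(d)/\dim d$ and $\mu(V)=\mu(\mathbf{dim}\,V)$; it is $\sigma$-compatible if $\sigma^*\theta=-\theta$. $V$ is semistable if $\mu(U)\le\mu(V)$ for all nonzero subrepresentations $U\subset V$. A self-dual $M$ (which has slope $0$) is $\sigma$-semistable if $\mu(U)\le 0$ for all nonzero isotropic subrepresentations $U\subset M$. $R_d^{\theta\text{-}ss}$, $R_e^{\sigma,\theta\text{-}ss}$ are the corresponding open subsets of $R_d$, $R_e^\sigma$. $\sigma$-HN types. Each self-dual representation $M$ has a unique $\sigma$-HN filtration (known result): an isotropic filtration $0=U_0\subset U_1\subset\cdots\subset U_r\subset M$ by subrepresentations with $U_k/U_{k-1}$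 semistable, $\mu(U_1/U_0)>\cdots>\mu(U_r/U_{r-1})>0$, and $M/\!\!/U_r$ zero or $\sigma$-semistable. A $\sigma$-HN type is a tuple $(d^\bullet,e^\infty)=(d^1,\dots,d^r,e^\infty)\in(\Lambda_Q^+)^r\times\Lambda_Q^{\sigma,+}$, $r\ge0$, with all $d^k\neq0$, $\mu(d^1)>\cdots>\mu(d^r)>0$, and $R_{d^1}^{\theta\text{-}ss},\dots,R_{d^r}^{\theta\text{-}ss},R_{e^\infty}^{\sigma,\theta\text{-}ss}$ all non-empty ($e^\infty=0$ is allowed). Its weight is $\sum_k(d^k+\sigma(d^k))+e^\infty$; $\mathsf{HN}^\sigma(e)$ is the set of $\sigma$-HN types of weight $e$. $R_{d^\bullet,e^\infty}^{\sigma,HN}\subset R_e^\sigma$ is the subset of self-dual representations whose $\sigma$-HN filtration has type $(d^\bullet,e^\infty)$, i.e. $\mathbf{dim}\,U_k/U_{k-1}=d^k$ and $\mathbf{dim}\,M/\!\!/U_r=e^\infty$. Order. For a tuple $c^\bullet=(c^1,\dots,c^n)$ of dimension vectors let $\mathcal{P}(c^\bullet)$ be the polygon (polygonal path) with vertices $(\dim\sum_{i\le k}c^i,\ \theta(\sum_{i\le k}c^i))$, $k=0,\dots,n$. For a $\sigma$-HN type put $\mathcal{P}(d^\bullet,e^\infty)=\mathcal{P}(d^1,\dots,d^r,e^\infty,\sigma(d^r),\dots,\sigma(d^1))$. Write $(d^\bullet,e^\infty)\le(d'^\bullet,e'^\infty)$ if $\mathcal{P}(d^\bullet,e^\infty)$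 lies on or below $\mathcal{P}(d'^\bullet,e'^\infty)$. *)

(* Defs.v *)
From HB Require Import structures.
From mathcomp Require Import all_boot all_order all_algebra.
From mathcomp Require Import mxrepresentation.
From mathcomp Require Import mpoly.

Set Implicit Arguments.
Unset Strict Implicit.
Unset Printing Implicit Defensive.

Import Order.TTheory GRing.Theory Num.Theory.
Local Open Scope ring_scope.

(* Conventions: vectors are row vectors, so a linear map f acts by x *m f, and
   a subspace of K^n is given by any n x n matrix having it as row space; hence
   subspaces are compared with (_ <= _)%MS.
   Sub- and quotient spaces are taken in coordinates, by means of
   val_submod / in_submod and val_factmod / in_factmod of mxrepresentation:
   the subspace W becomes K^(\rank W), and the quotient by U becomes
   K^(\rank (cokermx U)). *)

Record quiver := Quiver {
  vert : finType;
  arr : finType;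
  src : arr -> vert;
  tgt : arr -> vert }.

Record quiver_involution (Q : quiver) := QuiverInvolution {
  iv : vert Q -> vert Q;
  ia : arr Q -> arr Q;
  iv_involutive : involutive iv;
  ia_involutive : involutive ia;
  src_ia : forall a, src (ia a) = iv (tgt a);
  tgt_ia : forall a, tgt (ia a) = iv (src a);
  ia_fixed : forall a, tgt a = iv (src a) -> ia a = a }.

Definition is_sign (z : int) : bool := (z == 1) || (z == -1).

Record duality_structure (Q : quiver) (sg : quiver_involution Q) :=
  DualityStructure {
  ds : vert Q -> int;
  dtau : arr Q -> int;
  ds_sign : forall i, is_sign (ds i);
  dtau_sign : forall a, is_sign (dtau a);
  ds_iv : forall i, ds (iv sg i) = ds i;
  dtau_ia : forall a, dtau a * dtau (ia sg a) = ds (src a) * ds (tgt a) }.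

(* Elements of Lambda_Q^+. Representation spaces and slopes below are indexed
   by plain functions vert Q -> nat, to which elements of dimvec Q coerce. *)
Definition dimvec (Q : quiver) := {ffun vert Q -> nat}.

Section Stability.
Variable Q : quiver.

Definition sdual (sg : quiver_involution Q) (d : dimvec Q) : dimvec Q :=
  [ffun i => d (iv sg i)].

Definition dimtot (d : vert Q -> nat) : nat := (\sum_i d i)%N.

Definition stability := {additive {ffun vert Q -> int} -> int}.

Definition theta_dim (theta : stability) (d : vert Q -> nat) : int :=
  theta [ffun i => (d i)%:Z].

(* Since x / 0 = 0 in rat, the slope of 0 is 0. *)
Definition slope (theta : stability) (d : vert Q -> nat) : rat :=
  (theta_dim theta d)%:~R / (dimtot d)%:R.

Definition sigma_compatible (sg : quiver_involution Q) (theta : stability) :=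
  forall x : {ffun vert Q -> int},
    theta [ffun i => x (iv sg i)] = - theta x.

(* The elements of Lambda_Q^{sigma,+}, including the standing parity
   assumption. *)
Definition sd_dimvec (sg : quiver_involution Q) (D : duality_structure sg)
    (e : dimvec Q) : Prop :=
  (forall i, e (iv sg i) = e i) /\
  (forall i, iv sg i = i -> ds D i = -1 -> ~~ odd (e i)).

End Stability.

Section Representations.
Variables (K : fieldType) (Q : quiver).

(* The affine space R_d. *)
Definition rep (d : vert Q -> nat) :=
  forall a : arr Q, 'M[K]_(d (src a), d (tgt a)).

Definition zero_rep (d : vert Q -> nat) : rep d := fun a => 0.

Definition subsp (d : vert Q -> nat) := forall i : vert Q, 'M[K]_(d i).

Definition subdim d (U : subsp d) (i : vert Q) : nat := \rank (U i).

Definition quotdim d (U : subsp d) (i : vert Q) : nat :=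
  \rank (cokermx (U i)).

Definition sub_le d (U W : subsp d) : Prop := forall i, (U i <= W i)%MS.

Definition is_subrep d (m : rep d) (U : subsp d) : Prop :=
  forall a, (U (src a) *m m a <= U (tgt a))%MS.

Definition nonzero_sub d (U : subsp d) : Prop := exists i, U i != 0.

Definition sub_rep d (m : rep d) (W : subsp d) : rep (subdim W) :=
  fun a => in_submod (W (tgt a)) (val_submod 1%:M *m m a).

Definition quot_rep d (m : rep d) (U : subsp d) : rep (quotdim U) :=
  fun a => in_factmod (U (tgt a)) (val_factmod 1%:M *m m a).

(* For U contained in W, the subspace U regarded inside W. *)
Definition sub_in d (W U : subsp d) : subsp (subdim W) :=
  fun i => <<in_submod (W i) (U i)>>%MS.

Definition subquotdim d (W U : subsp d) : vert Q -> nat :=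
  quotdim (sub_in W U).

(* The representation W / U, for subrepresentations U and W with U <= W. *)
Definition subquot_rep d (m : rep d) (W U : subsp d) : rep (subquotdim W U) :=
  quot_rep (sub_rep m W) (sub_in W U).

Definition semistable (theta : stability Q) d (m : rep d) : Prop :=
  forall U : subsp d, is_subrep m U -> nonzero_sub U ->
    slope theta (subdim U) <= slope theta d.

(* A bilinear form on the total space of K^d, given by its blocks. *)
Definition bform (d : vert Q -> nat) :=
  forall i j : vert Q, 'M[K]_(d i, d j).

Definition bpair d (b : bform d) i j (x : 'rV[K]_(d i)) (y : 'rV[K]_(d j)) : K :=
  (x *m b i j *m y^T) 0 0.

Definition nondegenerate_form d (b : bform d) : Prop :=
  forall x : (forall i, 'rV[K]_(d i)),
    (forall y : (forall i, 'rV[K]_(d i)),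
      \sum_i \sum_j bpair b (x i) (y j) = 0) ->
    forall i, x i = 0.

Definition perp d (b : bform d) (U : subsp d) : subsp d :=
  fun i => (\bigcap_j kermx (b i j *m (U j)^T))%MS.

Definition isotropic d (b : bform d) (U : subsp d) : Prop :=
  forall i j (x : 'rV[K]_(d i)) (y : 'rV[K]_(d j)),
    (x <= U i)%MS -> (y <= U j)%MS -> bpair b x y = 0.

Definition sub_form d (b : bform d) (W : subsp d) : bform (subdim W) :=
  fun i j => val_submod (1%:M : 'M_(\rank (W i))) *m b i j
             *m (val_submod (1%:M : 'M_(\rank (W j))))^T.

Definition quot_form d (b : bform d) (U : subsp d) : bform (quotdim U) :=
  fun i j => val_factmod (1%:M : 'M_(\rank (cokermx (U i)))) *m b i j
             *m (val_factmod (1%:M : 'M_(\rank (cokermx (U j)))))^T.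

(* M // U = U^perp / U with its induced form, for U an isotropic
   subrepresentation of a self-dual representation. *)
Definition sdquotdim d (b : bform d) (U : subsp d) : vert Q -> nat :=
  subquotdim (perp b U) U.

Definition sdquot_rep d (b : bform d) (m : rep d) (U : subsp d) :
    rep (sdquotdim b U) :=
  subquot_rep m (perp b U) U.

Definition sdquot_form d (b : bform d) (U : subsp d) : bform (sdquotdim b U) :=
  quot_form (sub_form b (perp b U)) (sub_in (perp b U) U).

Definition sigma_semistable (theta : stability Q) d (b : bform d) (m : rep d) :
    Prop :=
  forall U : subsp d, is_subrep m U -> isotropic b U -> nonzero_sub U ->
    slope theta (subdim U) <= 0.

Section SelfDual.
Variables (sg : quiver_involution Q) (D : duality_structure sg).

(* In the third clause x and y run over M_i and M_(sigma i); on the remaining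
   part of M_i + M_(sigma i) the form vanishes by the second clause.
   In the last clause src (ia sg a) = sigma (tgt a) and
   tgt (ia sg a) = sigma (src a). *)
Definition selfdual_rep d (b : bform d) (m : rep d) : Prop :=
  [/\ nondegenerate_form b,
      forall i j, i != iv sg j -> b i j = 0,
      forall i (x : 'rV[K]_(d i)) (y : 'rV[K]_(d (iv sg i))),
        bpair b x y = (ds D i)%:~R * bpair b y x
    & forall a (x : 'rV[K]_(d (src a))) (y : 'rV[K]_(d (src (ia sg a)))),
        bpair b (x *m m a) y = (dtau D a)%:~R * bpair b x (y *m m (ia sg a))].

Definition selfdual_form d (b : bform d) : Prop := selfdual_rep b (zero_rep d).

Variable theta : stability Q.

(* U_0, ..., U_r are the values U 0, ..., U r; later values are irrelevant. *)
Definition sigma_HN_filtration d (b : bform d) (m : rep d)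
    (r : nat) (U : nat -> subsp d) : Prop :=
  [/\ (forall i, U 0%N i = 0),
      (forall k, (k <= r)%N -> is_subrep m (U k) /\ isotropic b (U k)),
      (forall k, (k < r)%N -> sub_le (U k) (U k.+1) /\
         semistable theta (subquot_rep m (U k.+1) (U k))),
      sorted >%R
        (rcons [seq slope theta (subquotdim (U k.+1) (U k)) | k <- iota 0 r] 0)
    & (forall i, sdquotdim b (U r) i = 0%N) \/
      sigma_semistable theta (sdquot_form b (U r)) (sdquot_rep b m (U r))].

(* The pair (d^1, ..., d^r), e^infinity. *)
Definition hn_data := (seq (dimvec Q) * dimvec Q)%type.

(* b is a choice of self-dual structure on each K^e. *)
Variable b : forall e : dimvec Q, bform e.

Definition is_sigma_HN_type (t : hn_data) : Prop :=
  [/\ (forall d, d \in t.1 -> (exists i, d i != 0%N) /\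
         exists m : rep d, semistable theta m),
      sorted >%R (rcons [seq slope theta d | d : dimvec Q <- t.1] 0),
      sd_dimvec D t.2
    & exists m : rep t.2,
        selfdual_rep (b t.2) m /\ sigma_semistable theta (b t.2) m].

Definition hn_weight (t : hn_data) : dimvec Q :=
  [ffun i => (\sum_(d <- t.1) (d i + sdual sg d i) + t.2 i)%N].

Definition HN_sigma (e : dimvec Q) (t : hn_data) : Prop :=
  is_sigma_HN_type t /\ hn_weight t = e.

(* The filtration being unique, "the type of the filtration of m is t" is
   expressed by the existence of a filtration of type t. *)
Definition HN_stratum (e : dimvec Q) (t : hn_data) (m : rep e) : Prop :=
  selfdual_rep (b e) m /\
  exists U : nat -> subsp e,
    [/\ sigma_HN_filtration (b e) m (size t.1) U,
        forall k, (k < size t.1)%N ->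
          subquotdim (U k.+1) (U k) =1 nth [ffun=> 0%N] t.1 k
      & sdquotdim (b e) (U (size t.1)) =1 t.2].

End SelfDual.

(* Zariski topology on the affine space R_d, with one polynomial variable for
   each entry of each structure map. *)
Definition coord (d : vert Q -> nat) : finType :=
  {a : arr Q & 'I_(d (src a)) * 'I_(d (tgt a))}%type.

Definition rep_coord d (m : rep d) (k : 'I_#|coord d|) : K :=
  let c := enum_val k in m (tag c) (tagged c).1 (tagged c).2.

Definition zariski_closed d (Z : rep d -> Prop) : Prop :=
  exists I : {mpoly K[#|coord d|]} -> Prop,
    forall m, Z m <-> (forall p, I p -> p.@[rep_coord m] = 0).

(* Closure of S in X, for the topology induced on X. *)
Definition zariski_closure_in d (X S : rep d -> Prop) (m : rep d) : Prop :=
  X m /\ forall Z, zariski_closed Z -> (forall m', S m' -> Z m') -> Z m.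

End Representations.

Section Polygons.
Variables (R : realFieldType) (Q : quiver) (theta : stability Q).

Definition vertex (c : seq (dimvec Q)) (k : nat) : R * R :=
  let s := fun i => (\sum_(d <- take k c) d i)%N in
  ((dimtot s)%:R, (theta_dim theta s)%:~R).

Definition polygon (c : seq (dimvec Q)) (p : R * R) : Prop :=
  exists k : nat, exists t : R,
    [/\ (k < size c)%N, 0 <= t <= 1
      & p = ((1 - t) * (vertex c k).1 + t * (vertex c k.+1).1,
             (1 - t) * (vertex c k).2 + t * (vertex c k.+1).2)].

Definition on_or_below (c c' : seq (dimvec Q)) : Prop :=
  forall x y y', polygon c (x, y) -> polygon c' (x, y') -> y <= y'.

Definition hn_path (sg : quiver_involution Q) (t : hn_data Q) :
    seq (dimvec Q) :=
  t.1 ++ t.2 :: rev [seq sdual sg d | d <- t.1].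

Definition hn_le (sg : quiver_involution Q) (t t' : hn_data Q) : Prop :=
  on_or_below (hn_path sg t) (hn_path sg t').

End Polygons.

(* Main.v *)
Require Import Defs.
From mathcomp Require Import all_boot all_order all_algebra.
From mathcomp Require Import mxrepresentation mpoly boolp.
From mathcomp Require Import reals complex ring lra zify.

(** Write h_mu(f) = theta(f) - mu * dim f for a dimension vector f and a
    rational number mu. In the plane of the points (dim f, theta(f)), h_mu(f) is
    the height above the line of slope mu through the origin. If for every
    segment of one polygon there is a mu such that no vertex of another polygon
    has larger h_mu than the end points of the segment, then the other polygon
    lies on or below the first one (hn_le_supporting). The theorem is obtained
    from two facts.

    First, having a subrepresentation of a given dimension vector is a closed
    condition (zariski_closed_has_subrep). If m' has type t and the filtration
    U_1, ..., U_r, then U_k and its orthogonal are subrepresentations of m', and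
    their dimension vectors are the vertices of P(t). Hence every m in the
    closure of the stratum has, for each vertex of P(t), a subrepresentation
    with the dimension vector of that vertex.

    Second, m lies in the stratum of some type t' such that both end points of
    each segment of P(t') maximise h_mu over all subrepresentations of m, for a
    suitable mu (exists_HN_stratum). Comparing the two facts gives t <= t'.

    For the second fact, consider the points (dim W, theta(W)) of all
    subrepresentations W. The vertices of the increasing part of the upper
    convex hull of these points are attained by subrepresentations U_k; they
    are nested because h_mu is modular on the lattice of subrepresentations
    (theta_maximal_sub), and maximality says at once that the subquotients
    are semistable. Taking orthogonals replaces h_mu by h_(- mu) up to a
    constant, so the last U_r, a maximiser of theta of least dimension, is
    contained in its orthogonal (maximal_isotropic), and the decreasing part of
    the hull consists of the orthogonals of the U_k. That t' is a type also
    requires moving the form of U_r^perp / U_r to the form chosen on the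
    standard space of the same dimension vector; this is the uniqueness of
    self-dual structures, proved by taking a square root, polynomial in X, of
    the matrix X that compares two forms (exists_isometry).

    The first fact is the properness of Grassmannians. It is proved by
    specialisation: a family of frames of subspaces is normalised so that a
    maximal minor is 1 and the entries tend to finite limits. For one function
    x, either x or 1 / x has a finite limit (extend_place), by an argument with
    resultants. From this one finds among finitely many functions one by which
    all the others can be divided (largest_coordinate), and this is applied to
    the maximal minors of the frames. *)

Set Implicit Arguments.
Unset Strict Implicit.
Unset Printing Implicit Defensive.

Import Order.TTheory GRing.Theory Num.Theory.
Local Open Scope ring_scope.

(** * Specialisation of families of points *)

(** The leading coefficients have to survive so that the two Sylvester matrices
    have the same size. *)
Lemma rmorph_resultant (A B : nzRingType) (f : {rmorphism A -> B})
    (p q : {poly A}) :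
    f (lead_coef p) != 0 -> f (lead_coef q) != 0 ->
  f (resultant p q) = resultant (map_poly f p) (map_poly f q).
Proof.
move=> nz_fp nz_fq; rewrite /resultant -det_map_mx /Sylvester_mx.
rewrite !size_map_poly_id0 //; congr (\det _); apply/matrixP => i j.
by rewrite !mxE; case: (split i) => k;
  rewrite !mxE /= !rVpoly_delta -coef_map rmorphM /= map_polyXn.
Qed.

Section Places.
Variables (K : closedFieldType) (S : Type).

(** A rule for taking limits along a family of points indexed by S. An element
    of the ring stands for a function on S through pl_ev, and pl_lim gives the
    limit of this function. By pl_spec, an identity that holds on the domain
    also holds in the limit: the limit point lies in the Zariski closure of the
    points of the domain. *)
Record place := Place {
  pl_ring : comNzRingType;
  pl_dom : S -> Prop;
  pl_ev : S -> {rmorphism pl_ring -> K};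
  pl_lim : {rmorphism pl_ring -> K};
  pl_cst : forall c, exists a, (forall s, pl_ev s a = c) /\ pl_lim a = c;
  pl_spec : forall a, (forall s, pl_dom s -> pl_ev s a = 0) -> pl_lim a = 0 }.

Definition limits (P : place) (g : S -> K) (l : K) : Prop :=
  exists a, (forall s, pl_dom P s -> pl_ev P s a = g s) /\ pl_lim P a = l.

(** Restricting the domain and enlarging the ring both refine a place. Only the
    graph of the limit is compared, so the two rings need not be related. *)
Definition refines (P P' : place) : Prop :=
  (forall s, pl_dom P' s -> pl_dom P s) /\
  (forall g l, limits P g l -> limits P' g l).

Lemma refines_refl P : refines P P. Proof. by []. Qed.

Lemma refines_trans P2 P1 P3 : refines P1 P2 -> refines P2 P3 -> refines P1 P3.
Proof. by move=> [d12 l12] [d23 l23]; split; auto. Qed.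

Section Limits.
Variable P : place.

Lemma limits_cst c : limits P (fun=> c) c.
Proof. by have [a [eva lima]] := pl_cst P c; exists a. Qed.

Lemma limitsD g h l k : limits P g l -> limits P h k ->
  limits P (fun s => g s + h s) (l + k).
Proof.
move=> [a [eva <-]] [b [evb <-]]; exists (a + b).
by split=> [s Ps|]; rewrite rmorphD //= eva ?evb.
Qed.

Lemma limitsM g h l k : limits P g l -> limits P h k ->
  limits P (fun s => g s * h s) (l * k).
Proof.
move=> [a [eva <-]] [b [evb <-]]; exists (a * b).
by split=> [s Ps|]; rewrite rmorphM //= eva ?evb.
Qed.

Lemma limits_sum (I : Type) (r : seq I) (g : I -> S -> K) (l : I -> K) :
  (forall i, limits P (g i) (l i)) ->
  limits P (fun s => \sum_(i <- r) g i s) (\sum_(i <- r) l i).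
Proof.
move=> lim_g; elim: r => [|i r IHr].
  rewrite big_nil; have [a [eva lima]] := limits_cst 0.
  by exists a; split=> // s Ps; rewrite eva ?big_nil.
rewrite big_cons; have [a [eva lima]] := limitsD (lim_g i) IHr.
by exists a; split=> // s Ps; rewrite eva ?big_cons.
Qed.

Lemma eq_limits g h l : (forall s, pl_dom P s -> g s = h s) ->
  limits P g l -> limits P h l.
Proof.
by move=> gh [a [eva lima]]; exists a; split=> // s Ps; rewrite eva ?gh.
Qed.

Lemma limits_uniq g h l k : (forall s, pl_dom P s -> g s = h s) ->
  limits P g l -> limits P h k -> l = k.
Proof.
move=> gh [a [eva <-]] [b [evb <-]]; apply/eqP; rewrite -subr_eq0 -rmorphB.
by apply/eqP/pl_spec => s Ps; rewrite rmorphB /= eva ?evb ?gh ?subrr.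
Qed.

Lemma place_nonempty : exists s, pl_dom P s.
Proof.
have [//|noP] := pselect (exists s, pl_dom P s).
have /eqP := @pl_spec P 1 (fun s Ps => False_ind _ (noP (ex_intro _ s Ps))).
by rewrite rmorph1 oner_eq0.
Qed.

End Limits.

(** If the limit violated an identity valid on D1 and also one valid on D2, it
    would violate their product, which is valid on the whole domain. *)
Lemma restrict_place (P : place) (D1 D2 : S -> Prop) :
    (forall s, pl_dom P s -> D1 s \/ D2 s) ->
  exists2 P', refines P P' &
    (forall s, pl_dom P' s -> D1 s) \/ (forall s, pl_dom P' s -> D2 s).
Proof.
move=> D12.
have mk (D : S -> Prop) :
    (forall a, (forall s, pl_dom P s /\ D s -> pl_ev P s a = 0) ->
       pl_lim P a = 0) ->
    exists2 P', refines P P' & forall s, pl_dom P' s -> D s.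
  move=> specD.
  exists (@Place _ (fun s => pl_dom P s /\ D s) (pl_ev P) (pl_lim P)
    (@pl_cst P) specD); last by move=> s [].
  split=> [s []//|g l [a [eva lima]]].
  by exists a; split=> // s [Ps _]; exact: eva.
have [sp1|/existsNP[a1]] := pselect (forall a,
    (forall s, pl_dom P s /\ D1 s -> pl_ev P s a = 0) -> pl_lim P a = 0).
  by have [P' PP' domP'] := mk _ sp1; exists P' => //; left.
move=> /not_implyP[va1 na1]; have [|P' PP' domP'] := mk D2; last first.
  by exists P' => //; right.
move=> a va; suff /eqP : pl_lim P (a1 * a) = 0.
  by rewrite rmorphM mulf_eq0 => /orP[/eqP//|/eqP].
apply: pl_spec => s Ps; rewrite rmorphM /=.
by case: (D12 s Ps) => Ds; [rewrite va1 ?mul0r|rewrite va ?mulr0].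
Qed.

Section Adjoin.
Variables (P : place) (x : S -> K).

Let A := pl_ring P.
Definition poly_ev (f : {rmorphism A -> K}) (c : K) :
    {rmorphism {poly A} -> K} :=
  horner_morph (fun a => mulrC c (f a)).

Lemma poly_evE f c (p : {poly A}) : poly_ev f c p = (map_poly f p).[c].
Proof. by []. Qed.

Lemma adjoin_place (D : S -> Prop) (l : K) (y : S -> K):
    (forall s, D s -> pl_dom P s) ->
    (forall p : {poly A}, (forall s, D s -> poly_ev (pl_ev P s) (y s) p = 0) ->
       poly_ev (pl_lim P) l p = 0) ->
  exists P', [/\ refines P P', forall s, pl_dom P' s -> D s & limits P' y l].
Proof.
move=> subD specD.
have cst c : exists p : {poly A}, (forall s, poly_ev (pl_ev P s) (y s) p = c)
    /\ poly_ev (pl_lim P) l p = c.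
  have [a [eva lima]] := pl_cst P c.
  by exists a%:P; split=> [s|];
    rewrite poly_evE map_polyC hornerC /= ?eva ?lima.
exists (@Place _ D (fun s => poly_ev (pl_ev P s) (y s)) (poly_ev (pl_lim P) l)
  cst specD).
split=> //.
  split=> // g k [a [eva lima]]; exists a%:P.
  by split=> [s /subD Ps|]; rewrite /= poly_evE map_polyC hornerC /= ?eva ?lima.
by exists 'X; split=> [s Ds|]; rewrite /= poly_evE map_polyX hornerX.
Qed.

Lemma lift_poly (q : {poly K}) : exists p : {poly A}, map_poly (pl_lim P) p = q.
Proof.
elim/poly_ind: q => [|q c [p <-]]; first by exists 0; rewrite rmorph0.
have [a [_ <-]] := pl_cst P c.
by exists (p * 'X + a%:P); rewrite rmorphD rmorphM /= map_polyX map_polyC.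
Qed.

Let vanishes (p : {poly A}) := forall s, pl_dom P s ->
  poly_ev (pl_ev P s) (x s) p = 0.

(** The limits of the polynomials that vanish at x form an ideal of K[X]. An
    element of least degree divides all the others, so over an algebraically
    closed field it has no root unless the whole ideal has a common one. *)
Lemma vanishing_unit :
    (forall l, exists2 p, vanishes p & (map_poly (pl_lim P) p).[l] != 0) ->
  exists2 p, vanishes p & size (map_poly (pl_lim P) p) = 1%N.
Proof.
move=> sep; have [p0 vp0 nzp0] := sep 0.
have {nzp0} : map_poly (pl_lim P) p0 != 0.
  by apply: contraNneq nzp0 => ->; rewrite horner0.
move: {2}(size _) (leqnn (size (map_poly (pl_lim P) p0))) => n.
elim: n p0 vp0 => [|n IHn] p vp; first by rewrite leqn0 size_poly_eq0 => ->.
move=> szp nzp; have [sz1|sz1] := eqVneq (size (map_poly (pl_lim P) p)) 1%N.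
  by exists p.
have /closed_rootP[l rootl] := sz1; have [q vq nzq] := sep l.
have [h hE] := lift_poly (map_poly (pl_lim P) q %/ map_poly (pl_lim P) p).
have rE : map_poly (pl_lim P) (q - h * p) =
    map_poly (pl_lim P) q %% map_poly (pl_lim P) p.
  rewrite rmorphB rmorphM /= hE.
  by rewrite {1}(divp_eq (map_poly (pl_lim P) q) (map_poly (pl_lim P) p)) addrC
    addKr.
apply: (IHn (q - h * p)).
- by move=> s Ps; rewrite rmorphB rmorphM /= vq ?vp ?mulr0 ?subrr.
- by rewrite rE -ltnS (leq_trans _ szp) // ltn_modp.
rewrite rE; apply: contraNneq nzq => r0.
rewrite (divp_eq (map_poly (pl_lim P) q) (map_poly (pl_lim P) p)) r0 addr0
  hornerM.
by rewrite (rootP rootl) mulr0.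
Qed.

(** This is the properness of the projective line. If x cannot be given a finite
    limit, then x is a root along the family of some g whose limit is a nonzero
    constant. If 1 / x cannot be given the limit 0 either, then x is a root of
    some f whose leading coefficient has a nonzero limit. The resultant of f and
    g then vanishes along the family, but not in the limit, where the two
    polynomials are coprime. *)
Lemma extend_place :
  (exists P' l, refines P P' /\ limits P' x l) \/
  (exists P', [/\ refines P P', forall s, pl_dom P' s -> x s != 0
     & limits P' (fun s => (x s)^-1) 0]).
Proof.
have [[l specl]|nol] := pselect (exists l, forall p, vanishes p ->
    poly_ev (pl_lim P) l p = 0).
  left; have [|P' [PP' _ limx]] := @adjoin_place (pl_dom P) l x _ specl => //.
  by exists P', l.
right; pose D s := pl_dom P s /\ x s != 0.
have [sp|] := pselect (forall p : {poly A}, (forall s, D s ->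
    poly_ev (pl_ev P s) (x s)^-1 p = 0) -> poly_ev (pl_lim P) 0 p = 0).
  have [|P' [PP' domP' limx]] := @adjoin_place D 0 (fun s => (x s)^-1) _ sp.
    by move=> s [].
  by exists P'; split=> // s /domP'[].
move=> /existsNP[q /not_implyP[vq /eqP nzq]]; exfalso.
have nzq0 : pl_lim P q`_0 != 0.
  by move: nzq; rewrite poly_evE horner_coef0 coef_map.
have sep l : exists2 p, vanishes p & (map_poly (pl_lim P) p).[l] != 0.
  apply: contrapT => noP; apply: nol; exists l => p vp.
  by apply: contrapT => /eqP nzp; apply: noP; exists p.
have [g vg sz_g] := vanishing_unit sep.
(* The polynomial q reversed, times X: the extra factor makes f vanish at x s
   also where x s = 0. *)
pose N := size q.
pose f : {poly A} := \poly_(i < N.+1) q`_(N - i).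
have sz_f : size f = N.+1.
  apply: size_poly_eq; rewrite subnn.
  by apply: contraNneq nzq0 => ->; rewrite rmorph0.
have lead_f : lead_coef f = q`_0.
  by rewrite lead_coefE sz_f coef_poly leqnn subnn.
have N_gt0 : (0 < N)%N.
  rewrite lt0n size_poly_eq0; apply: contraNneq nzq0 => ->.
  by rewrite coef0 rmorph0.
have vf : vanishes f.
  move=> s Ps; rewrite poly_evE.
  have -> :
      map_poly (pl_ev P s) f = \poly_(i < N.+1) pl_ev P s q`_(N - i).
    by apply/polyP => i; rewrite coef_map !coef_poly /=; case: ifP => // _;
      rewrite rmorph0.
  rewrite horner_poly big_ord_recl subn0 (nth_default 0 (leqnn N)) rmorph0 mul0r
    add0r.
  have [x0|x0] := eqVneq (x s) 0.
    by rewrite big1 // => i _; rewrite x0 expr0n mulr0.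
  have := vq s (conj Ps x0); rewrite poly_evE => q0.
  transitivity ((x s) ^+ N * (map_poly (pl_ev P s) q).[(x s)^-1]); last first.
    by rewrite q0 mulr0.
  rewrite (horner_coef_wide _ (size_poly _ _)) -/N mulr_sumr.
  rewrite [RHS](reindex_inj rev_ord_inj) /=; apply: eq_bigr => i _.
  have lt_i := ltn_ord i.
  rewrite coef_map /= mulrCA exprVn /bump leq0n add1n.
  congr (_ * _); rewrite -expfB_cond ?(negPf x0) ?add0n ?leq_subr //.
  by rewrite subKn.
(* A high multiple of f gives g a leading coefficient with a nonzero limit and
   does not change the ideal generated by f and g. *)
pose g' := g + f * 'X^(size g).
have sz_fX : size (f * 'X^(size g)) = (N.+1 + size g)%N.
  by rewrite size_mulXn -?size_poly_eq0 sz_f // addnC.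
have lt_g : (size g < size (f * 'X^(size g))%R)%N by rewrite sz_fX ltnS
  leq_addl.
have lead_g' : lead_coef g' = q`_0.
  by rewrite /g' lead_coefDr // lead_coef_Mmonic ?monicXn.
have vg' : vanishes g'.
  by move=> s Ps; rewrite rmorphD rmorphM /= vg // vf // mul0r addr0.
have f_gt1 : (1 < size f)%N by rewrite sz_f ltnS.
have g'_gt1 : (1 < size g')%N.
  rewrite /g' addrC size_polyDl //; apply: leq_ltn_trans lt_g.
  rewrite lt0n size_poly_eq0; apply/eqP => g0.
  by move: sz_g; rewrite g0 rmorph0 size_poly0.
have [[u v] /= _ res_uv] := resultant_in_ideal f_gt1 g'_gt1.
have /eqP : pl_lim P (resultant f g') = 0.
  apply: pl_spec => s Ps.
  have := congr1 (poly_ev (pl_ev P s) (x s)) res_uv.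
  rewrite rmorphD !rmorphM /= vf // vg' // !mulr0 addr0.
  by rewrite poly_evE map_polyC hornerC.
rewrite rmorph_resultant ?lead_f ?lead_g' // resultant_eq0.
rewrite /g' rmorphD rmorphM /= addrC mulrC (eqp_size (gcdp_addl_mul _ _ _)).
apply/negP; rewrite -leqNgt -sz_g dvdp_leq ?dvdp_gcdr //.
by rewrite -size_poly_eq0 sz_g.
Qed.

End Adjoin.
End Places.

Section Projective.
Variables (K : closedFieldType) (S : Type).
Implicit Type P : place K S.

(** This is the properness of projective space: after a refinement, either all
    the coordinates in the list vanish, or one of them dominates the others.
    When a new coordinate p i is compared with the dominating p i0 and their
    ratio has no finite limit, p i takes over, since p j / p i is the product of
    p j / p i0 with a function that tends to 0. *)
Lemma largest_coordinate (I : eqType) (p : I -> S -> K) P (r : seq I) :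
  exists2 P', refines P P' &
    (forall i s, i \in r -> pl_dom P' s -> p i s = 0) \/
    (exists i0, (forall s, pl_dom P' s -> p i0 s != 0) /\
       forall i, i \in r -> exists l, limits P' (fun s => p i s / p i0 s) l).
Proof.
elim: r => [|i r [P1 PP1 IHr]].
  by exists P; [exact: refines_refl|left].
case: IHr => [all0|[i0 [nz0 lim0]]].
  have [|P2 P12 domP2] := @restrict_place _ _ P1
    (fun s => p i s = 0) (fun s => p i s != 0).
    by move=> s _; have [|] := eqVneq (p i s) 0; [left|right].
  have P02 := refines_trans PP1 P12; exists P2 => //.
  case: domP2 => dom2; [left|right].
    move=> j s; rewrite inE => /orP[/eqP->|jr] P2s; first exact: dom2.
    by rewrite all0 //; apply: P12.1.
  exists i; split=> // j; rewrite inE => /orP[/eqP->|jr].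
    exists 1; apply: eq_limits (limits_cst P2 1) => s /dom2 nz.
    by rewrite divff.
  exists 0; apply: eq_limits (limits_cst P2 0) => s /P12.1 P1s.
  by rewrite all0 // mul0r.
have [[P2 [l [P12 liml]]]|[P2 [P12 dom2 lim_inv]]] :=
  extend_place P1 (fun s => p i s / p i0 s);
  have P02 := refines_trans PP1 P12; exists P2 => //; right.
  exists i0; split=> [s /P12.1/nz0 //|j].
  rewrite inE => /orP[/eqP->|/lim0[k limk]]; first by exists l.
  by exists k; apply: P12.2.
have nz2 s : pl_dom P2 s -> p i s != 0.
  by move=> /dom2; rewrite mulf_eq0 negb_or => /andP[].
exists i; split=> // j; rewrite inE => /orP[/eqP->|/lim0[k limk]].
  exists 1; apply: eq_limits (limits_cst P2 1) => s /nz2 nz.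
  by rewrite divff.
exists (k * 0); apply: eq_limits (limitsM (P12.2 _ _ limk) lim_inv) => s P2s.
have nzi := nz2 s P2s; have nz0s := nz0 s (P12.1 _ P2s).
by rewrite invf_div mulrA divfK.
Qed.

(** Choose the columns f whose minor dominates all the others. By Cramer's rule,
    the entries of the frame normalised to be the identity on these columns are
    quotients of maximal minors by the dominating one. *)
Lemma minor_limit (n d : nat) (U : S -> 'M[K]_(n, d)) P :
    (forall s, pl_dom P s -> row_free (U s)) ->
  exists2 P', refines P P' &
    exists (f : 'I_d ^ n) (B : 'M[K]_(n, d)),
      (forall s, pl_dom P' s -> colsub f (U s) \in unitmx) /\
      (forall i j, limits P' (fun s => (invmx (colsub f (U s)) *m U s) i j)
        (B i j)).
Proof.
move=> freeU; pose p (f : 'I_d ^ n) s := \det (colsub f (U s)).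
have [P' PP' limP'] := largest_coordinate p P (enum {: 'I_d ^ n}).
exists P' => //; case: limP' => [all0|[f [nzf limf]]].
  have [s P's] := place_nonempty P'; have fullU : row_full (U s)^T.
    by rewrite /row_full mxrank_tr; apply: freeU; apply: PP'.1.
  have := fullrowsub_unit fullU.
  set f := fullrankfun _; have := all0 f s (mem_enum _ _) P's.
  rewrite /p => det0; rewrite unitmxE.
  rewrite -det_tr [X in \det X](_ : _ = colsub f (U s)) ?det0 ?unitr0 //.
  by apply/matrixP => i j; rewrite !mxE.
have unitf s : pl_dom P' s -> colsub f (U s) \in unitmx.
  by move=> P's; rewrite unitmxE unitfE; apply: nzf.
pose g (i : 'I_n) (j : 'I_d) : 'I_d ^ n :=
  [ffun k => if k == i then j else f k].
have /= ratio i : exists l, forall j, limits P' (fun s => p (g i j) s / p f s)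
  (l j).
  pose R (j : 'I_d) (l : K) := limits P' (fun s => p (g i j) s / p f s) l.
  by apply: (@fin_all_exists _ _ R) => j; apply: limf; rewrite mem_enum.
have /fin_all_exists[l liml] := ratio.
exists f, (\matrix_(i, j) l i j); split=> // i j; rewrite mxE.
apply: eq_limits (liml i j) => s P's;
  rewrite /invmx unitf // -scalemxAl mxE mulrC.
congr (_ * _); rewrite /p (expand_det_col _ i) mxE; apply: eq_bigr => k _.
rewrite !mxE ffunE eqxx mulrC; congr (_ * _); rewrite /cofactor;
  congr (_ * \det _).
apply/matrixP => a b; rewrite !mxE ffunE; case: eqP => // /eqP.
by rewrite eq_sym (negPf (neq_lift _ _)).
Qed.

End Projective.

(** * Subrepresentations of prescribed dimension vector *)

Lemma exists_row_basis (F : fieldType) (n k : nat) (U : 'M[F]_n) :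
  \rank U = k -> exists2 B : 'M[F]_(k, n), row_free B & (B :=: U)%MS.
Proof.
by move=> <-; exists (row_base U); [exact: row_base_free|exact: eq_row_base].
Qed.

Definition has_subrep (K : fieldType) (Q : quiver) (d f : vert Q -> nat)
    (m : rep K d) : Prop :=
  exists U : subsp K d, is_subrep m U /\ subdim U =1 f.

Section SubrepLocus.
Variables (K : closedFieldType) (Q : quiver) (d : vert Q -> nat).

Let S f := (rep K d * (forall i, 'M[K]_(f i, d i)))%type.

(** Recording a subrepresentation by a basis of each component gives it
    coordinates, whose limits can be taken. *)
Definition framed f (s : S f) : Prop :=
  (forall i, row_free (s.2 i)) /\
  (forall a, (s.2 (src a) *m s.1 a <= s.2 (tgt a))%MS).

Lemma has_subrep_framed f m :
  @has_subrep K Q d f m <-> exists B, @framed f (m, B).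
Proof.
split=> [[U [subU dimU]]|[B [freeB subB]]].
  have /fin_all_exists2[B freeB BU] : forall i, exists2 B : 'M[K]_(f i, d i),
    row_free B & (B :=: U i)%MS by move=> i; apply: exists_row_basis;
      exact: dimU.
  exists B; split=> //= a; rewrite BU; apply: submx_trans (subU a).
  by rewrite submxMr ?BU.
exists (fun i => <<B i>>%MS); split=> [a|i].
  by rewrite genmxE; apply: submx_trans (subB a); rewrite submxMr ?genmxE.
by rewrite /subdim genmxE (eqP (freeB i)).
Qed.

Lemma rows_limit f (P : place K (S f)) (r : seq (vert Q)) :
    (forall s, pl_dom P s -> framed s) ->
  exists2 P', refines P P' &
    forall i, i \in r -> exists (c : 'I_(d i) ^ f i) (B : 'M[K]_(f i, d i)),
      (forall s, pl_dom P' s -> colsub c (s.2 i) \in unitmx) /\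
      (forall j k, limits P' (fun s => (invmx (colsub c (s.2 i)) *m s.2 i) j k)
        (B j k)).
Proof.
move=> framedP; elim: r => [|i r [P1 PP1 IHr]]; first by exists P => //;
  apply: refines_refl.
have [|P2 P12 lim2] := @minor_limit K (S f) (f i) (d i) (fun s => s.2 i) P1.
  by move=> s /PP1.1/framedP[].
exists P2; first exact: refines_trans P12.
move=> j; rewrite inE => /orP[/eqP->|/IHr[c [B [unitc limB]]]] //.
exists c, B; split=> [s /P12.1/unitc//|k l]; exact: P12.2.
Qed.

(** Let m satisfy all the polynomial identities that hold for the
    representations with such a subrepresentation. Specialise from these
    representations to m in such a way that normalised frames of the
    subrepresentations have limits. The limit frames contain an identity matrix,
    so their ranks do not drop. Being invariant is an identity between the
    entries of the normalised frames and of the representation, so it passes to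
    the limit. *)
Lemma zariski_closed_has_subrep f : zariski_closed (@has_subrep K Q d f).
Proof.
exists (fun p => forall m, has_subrep f m -> p.@[rep_coord m] = 0) => m.
split=> [subm p|specm]; first exact.
have cst c : exists a : {mpoly K[#|Defs.coord d|]},
    (forall s : S f, meval (rep_coord s.1) a = c) /\ meval (rep_coord m) a = c.
  by exists c%:MP; split=> [s|]; rewrite mevalC.
have spec (a : {mpoly K[#|Defs.coord d|]}) :
    (forall s : S f, framed s -> meval (rep_coord s.1) a = 0) ->
    meval (rep_coord m) a = 0.
  move=> va; apply: specm => m' /has_subrep_framed[B fB].
  exact: (va (m', B)).
pose P0 := @Place K (S f) {mpoly K[#|Defs.coord d|]} (@framed f)
  (fun s => meval (rep_coord s.1)) (meval (rep_coord m)) cst spec.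
have [//|P P0P lim_rows] := @rows_limit f P0 (enum (vert Q)).
have domP s : pl_dom P s -> framed s by move=> /P0P.1.
have lim_m a i j : limits P (fun s => s.1 a i j) (m a i j).
  pose entry a' := ('I_(d (src a')) * 'I_(d (tgt a')))%type.
  apply: P0P.2; exists 'X_(enum_rank (Tagged entry (i, j))).
  by split=> [s _|]; rewrite /= mevalXU /rep_coord enum_rankK.
have /fin_all_exists[c /fin_all_exists[B limB]] :
    forall i, exists (c : 'I_(d i) ^ f i) (B : 'M[K]_(f i, d i)),
      (forall s, pl_dom P s -> colsub c (s.2 i) \in unitmx) /\
      (forall j k, limits P (fun s => (invmx (colsub c (s.2 i)) *m s.2 i) j k)
        (B j k)).
  by move=> i; apply: lim_rows; rewrite mem_enum.
pose W (s : S f) i := invmx (colsub (c i) (s.2 i)) *m s.2 i.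
have W1 s i : pl_dom P s -> colsub (c i) (W s i) = 1%:M.
  by move=> Ps; rewrite /W -mulmx_colsub mulVmx // (limB i).1.
have limW i j k : limits P (fun s => W s i j k) (B i j k) by exact: (limB i).2.
have B1 i : colsub (c i) (B i) = 1%:M.
  apply/matrixP => j k; rewrite mxE.
  apply: limits_uniq (limW i j (c i k)) (limits_cst P _) => s Ps /=.
  by have /matrixP/(_ j k) := W1 s i Ps; rewrite mxE.
apply/has_subrep_framed; exists B; split=> [i|a] /=.
  apply/row_freeP; exists (colsub (c i) 1%:M).
  by rewrite mulmx_colsub mulmx1 B1.
suff -> : B (src a) *m m a = colsub (c (tgt a)) (B (src a) *m m a) *m B (tgt a).
  exact: submxMl.
have limWm i j : limits P (fun s => (W s (src a) *m s.1 a) i j)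
  ((B (src a) *m m a) i j).
  rewrite mxE.
  have L := limits_sum (index_enum _) (fun k =>
    limitsM (limW (src a) i k) (lim_m a k j)).
  apply: eq_limits L => s _.
  by rewrite mxE.
have limR i j : limits P
    (fun s => (colsub (c (tgt a)) (W s (src a) *m s.1 a) *m W s (tgt a)) i j)
    ((colsub (c (tgt a)) (B (src a) *m m a) *m B (tgt a)) i j).
  rewrite mxE; under eq_bigr do rewrite mxE.
  have L := limits_sum (index_enum _) (fun k =>
    limitsM (limWm i (c (tgt a) k)) (limW _ k j)).
  apply: eq_limits L => s _.
  by rewrite mxE; apply: eq_bigr => k _; rewrite [in RHS]mxE.
apply/matrixP => i j; apply: limits_uniq (limWm i j) (limR i j) => s Ps.
have /submxP[D ->] : (W s (src a) *m s.1 a <= W s (tgt a))%MS.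
  rewrite /W -mulmxA; apply: submx_trans (submxMl _ _) _.
  have inv_full : row_full (invmx (colsub (c (tgt a)) (s.2 (tgt a)))).
    by rewrite row_full_unit unitmx_inv (limB _).1.
  by rewrite (eqmxMfull _ inv_full); apply: (domP s Ps).2.
by rewrite -mulmx_colsub W1 // mulmx1.
Qed.

End SubrepLocus.

(** * Subquotients in the coordinates of the ambient space *)

Lemma val_submodM (F : fieldType) n (U : 'M[F]_n) p q (A : 'M_(p, q)) B :
  val_submod (A *m B : 'M_(p, \rank U)) = A *m val_submod B.
Proof. by rewrite val_submodE [val_submod B]val_submodE mulmxA. Qed.

Lemma val_factmodM (F : fieldType) n (U : 'M[F]_n) p q (A : 'M_(p, q)) B :
  val_factmod (A *m B : 'M_(p, \rank (cokermx U))) = A *m val_factmod B.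
Proof. by rewrite val_factmodE [val_factmod B]val_factmodE mulmxA. Qed.

Fact lift_key : unit. Proof. exact: tt. Qed.

Section Subquotients.
Variables (K : fieldType) (Q : quiver) (d : vert Q -> nat) (m : rep K d).
Implicit Types (U W V X : subsp K d).

Definition cap_sub U V : subsp K d := fun i => (U i :&: V i)%MS.
Definition add_sub U V : subsp K d := fun i => (U i + V i)%MS.

Lemma cap_subrep U V : is_subrep m U -> is_subrep m V ->
  is_subrep m (cap_sub U V).
Proof.
move=> subU subV a; rewrite sub_capmx.
rewrite (submx_trans _ (subU a)) ?submxMr ?capmxSl //=.
by rewrite (submx_trans _ (subV a)) ?submxMr ?capmxSr.
Qed.

Lemma add_subrep U V : is_subrep m U -> is_subrep m V ->
  is_subrep m (add_sub U V).
Proof. by move=> subU subV a; rewrite addsmxMr addsmxS. Qed.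

Lemma subdim_add_cap U V i :
  (subdim (add_sub U V) i + subdim (cap_sub U V) i = subdim U i + subdim V i)%N.
Proof. exact: mxrank_sum_cap. Qed.

Section Lift.
Variables (W U : subsp K d).

(** The rows lift the standard basis of the coordinate space of W / U to W. Only
    the relations of these matrices to U, W, the structure maps and the form
    matter later, never their entries; hence the lock. *)
Definition lift_subquot i : 'M[K]_(subquotdim W U i, d i) :=
  locked_with lift_key
    (val_factmod (1%:M : 'M_(\rank (cokermx (sub_in W U i)))) *m
     val_submod 1%:M).

Let L := lift_subquot.

Lemma lift_subquotE i : L i =
  val_submod (val_factmod (1%:M : 'M_(\rank (cokermx (sub_in W U i))))).
Proof. by rewrite [RHS]val_submodE /L /lift_subquot locked_withE. Qed.

Lemma lift_subquot_sub i : (L i <= W i)%MS.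
Proof. by rewrite lift_subquotE val_submodP. Qed.

Hypothesis UW : sub_le U W.

Lemma lift_subquot_inj i k (x : 'M_(k, subquotdim W U i)) :
  (x *m L i <= U i)%MS -> x = 0.
Proof.
pose S := sub_in W U i.
have : x *m L i = val_submod (val_factmod (x : 'M_(k, \rank (cokermx S)))).
  by rewrite lift_subquotE -val_submodM -val_factmodM mulmx1.
move=> -> xU; apply: (@val_factmod_inj _ _ S); rewrite linear0.
have : (val_factmod (x : 'M_(k, \rank (cokermx S))) <= S)%MS.
  by rewrite genmxE -val_submodS in_submodK ?UW.
by rewrite -in_factmod_eq0 val_factmodK => /eqP->; rewrite linear0.
Qed.

Lemma lift_subquot_span i : (W i <= U i + L i)%MS.
Proof.
pose S := sub_in W U i; set v : 'M_(\rank (cokermx S), _) := val_factmod 1%:M.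
have S1 : (1%:M <= S + v)%MS.
  rewrite -[X in (X <= _)%MS](add_sub_fact_mod S)
    addmx_sub_adds ?val_submodP //.
  by rewrite val_factmodE submxMl.
rewrite -(val_submod1 (W i)) -[X in (X <= _)%MS]mul1mx.
apply: submx_trans (submxMr _ S1) _.
rewrite addsmxMr lift_subquotE [X in (_ <= _ + X)%MS]val_submodE addsmxS //.
have <- : val_submod (in_submod (W i) (U i)) = U i by rewrite in_submodK.
by rewrite [X in (_ <= X)%MS]val_submodE submxMr ?genmxE.
Qed.

Hypotheses (subU : is_subrep m U) (subW : is_subrep m W).

Lemma lift_subquot_hom a :
  (L (src a) *m m a - subquot_rep m W U a *m L (tgt a) <= U (tgt a))%MS.
Proof.
set n := sub_rep m W a.
set v := val_factmod (1%:M : 'M_(\rank (cokermx (sub_in W U (src a))))).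
have valn : val_submod n = val_submod (1%:M : 'M_(\rank (W (src a)))) *m m a.
  by rewrite in_submodK //; apply: submx_trans (subW a);
    rewrite submxMr ?val_submod1.
have -> : L (src a) *m m a = val_submod (v *m n).
  by rewrite val_submodM valn mulmxA lift_subquotE [val_submod v]val_submodE.
have -> : subquot_rep m W U a *m L (tgt a) =
    val_submod (val_factmod (in_factmod (sub_in W U (tgt a)) (v *m n))).
  by rewrite lift_subquotE -val_submodM -val_factmodM mulmx1.
rewrite -raddfB /= -(in_submodK (UW (tgt a))) val_submodS
  -(genmxE (in_submod _ _)).
by rewrite -in_factmod_eq0 raddfB /= val_factmodK subrr.
Qed.

End Lift.

(** The subrepresentation between U and W that corresponds to X. *)
Definition pull_subquot W U (X : subsp K (subquotdim W U)) : subsp K d :=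
  fun i => (X i *m lift_subquot W U i + U i)%MS.

Section Pull.
Variables (W U : subsp K d).
Hypothesis UW : sub_le U W.
Let L := lift_subquot W U.

Lemma mxrank_lift i k (x : 'M_(k, subquotdim W U i)) :
  \rank (x *m L i + U i)%MS = (\rank x + \rank (U i))%N.
Proof.
have := mxrank_sum_cap (x *m L i) (U i).
have -> : \rank (x *m L i :&: U i)%MS = 0%N.
  apply/eqP; rewrite mxrank_eq0; apply/eqP.
  have /submxP[D DE] := capmxSl (x *m L i) (U i).
  have := capmxSr (x *m L i) (U i); rewrite DE mulmxA =>
    /(lift_subquot_inj UW) ->.
  by rewrite mul0mx.
rewrite addn0 => ->; congr (_ + _)%N; apply: mxrankMfree.
rewrite -kermx_eq0; apply/eqP/(lift_subquot_inj UW).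
by rewrite mulmx_ker sub0mx.
Qed.

Lemma subquotdimE i : (subquotdim W U i + subdim U i = subdim W i)%N.
Proof.
have := mxrank_lift (1%:M : 'M_(subquotdim W U i));
  rewrite mxrank1 mul1mx => <-.
apply/eqmx_rank; rewrite addsmxC addsmx_sub UW /L lift_subquot_sub.
exact: lift_subquot_span.
Qed.

Variable X : subsp K (subquotdim W U).
Let V := pull_subquot X.

Lemma pull_subquot_dim i : subdim V i = (subdim X i + subdim U i)%N.
Proof. exact: mxrank_lift. Qed.

Lemma pull_subquot_subrep : is_subrep m U -> is_subrep m W ->
  is_subrep (subquot_rep m W U) X -> is_subrep m V.
Proof.
move=> subU subW subX a; rewrite addsmxMr addsmx_sub.
rewrite (submx_trans (subU a)) ?addsmxSr // andbT -mulmxA.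
rewrite -[L (src a) *m m a](subrK (subquot_rep m W U a *m L (tgt a))) mulmxDr.
rewrite addmx_sub //.
  apply: submx_trans (submxMl _ _) _.
  by apply: submx_trans (addsmxSr _ _); apply: lift_subquot_hom.
by apply: submx_trans (addsmxSl _ _); rewrite mulmxA submxMr.
Qed.

End Pull.

Lemma sdquot_formE (b : bform K d) U i j :
  sdquot_form b U i j =
  lift_subquot (perp b U) U i *m b i j *m (lift_subquot (perp b U) U j)^T.
Proof.
rewrite /sdquot_form /quot_form /sub_form /lift_subquot !locked_withE.
move: (val_factmod _) (val_factmod _) (val_submod _) (val_submod _) => A B C D.
by rewrite trmx_mul !mulmxA.
Qed.

End Subquotients.

(** * Self-dual forms and orthogonals *)

Lemma eq_mx_pairing (F : fieldType) p q (A B : 'M[F]_(p, q)) :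
  (forall (x : 'rV_p) (y : 'rV_q), (x *m A *m y^T) 0 0 = (x *m B *m y^T) 0 0) ->
  A = B.
Proof.
move=> AB; apply/matrixP => i j.
have E (C : 'M[F]_(p, q)) : C i j =
      ((delta_mx 0 i : 'rV_p) *m C *m (delta_mx 0 j : 'rV_q)^T) 0 0.
  by rewrite -rowE trmx_delta -colE !mxE.
by rewrite (E A) (E B) AB.
Qed.

Section SelfDualForms.
Variables (K : fieldType) (Q : quiver) (sg : quiver_involution Q).
Variables (D : duality_structure sg) (d : vert Q -> nat) (b : bform K d).
Variable m : rep K d.
Hypothesis sdm : selfdual_rep D b m.
Implicit Types (U W V X : subsp K d).

(** The form only pairs the component i with the component iv i, so each of
    these blocks is itself a perfect pairing. *)
Lemma selfdual_block_free i : row_free (b i (iv sg i)).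
Proof.
have [nondeg off _ _] := sdm.
rewrite -kermx_eq0; apply/eqP/row_matrixP => k; rewrite row0.
set x := row k _; have xb : x *m b i (iv sg i) = 0.
  by apply/sub_kermxP; apply: row_sub.
pose z := dfwith (fun j => 0 : 'rV[K]_(d j)) x.
have <- : z i = x by rewrite /z dfwith_in.
apply: nondeg => y; rewrite big1 // => j _; rewrite big1 // => l _;
  rewrite /bpair.
have [<- | ij] := eqVneq i j; last by rewrite /z dfwith_out // !mul0mx mxE.
have [il | il] := eqVneq i (iv sg l); last by rewrite off // mulmx0 mul0mx mxE.
have -> : l = iv sg i by rewrite il iv_involutive.
by rewrite /z dfwith_in xb mul0mx mxE.
Qed.

Lemma selfdual_dim i : d (iv sg i) = d i.
Proof.
have le j : (d j <= d (iv sg j))%N.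
  by rewrite -{1}(eqP (selfdual_block_free j)) rank_leq_col.
by apply/eqP; rewrite eqn_leq le -{2}(iv_involutive sg i) le.
Qed.

Lemma selfdual_block_full i : row_full (b i (iv sg i)).
Proof. by rewrite /row_full (eqP (selfdual_block_free i)) selfdual_dim. Qed.

Lemma selfdual_sym i j : b i j = (ds D i)%:~R *: (b j i)^T.
Proof.
have [_ off sym _] := sdm.
have [-> | ji] := eqVneq j (iv sg i); last first.
  rewrite !off ?trmx0 ?scaler0 //.
  by apply: contra ji => /eqP->; rewrite iv_involutive.
apply: eq_mx_pairing => x y; have := sym i x y; rewrite /bpair => ->.
rewrite -scalemxAr -scalemxAl [RHS]mxE; congr (_ * _).
have -> : x *m (b (iv sg i) i)^T *m y^T = (y *m b (iv sg i) i *m x^T)^T.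
  by rewrite !trmx_mul trmxK mulmxA.
by rewrite [RHS]mxE.
Qed.

Lemma selfdual_adj a : m a *m b (tgt a) (src (ia sg a)) =
  (dtau D a)%:~R *: (b (src a) (tgt (ia sg a)) *m (m (ia sg a))^T).
Proof.
have [_ _ _ adj] := sdm; apply: eq_mx_pairing => x y.
have := adj a x y; rewrite /bpair !mulmxA => ->.
by rewrite -scalemxAr -scalemxAl [RHS]mxE trmx_mul !mulmxA.
Qed.

Lemma sub_perpP k i (A : 'M_(k, d i)) U :
  reflect (forall j, A *m b i j *m (U j)^T = 0) (A <= perp b U i)%MS.
Proof.
apply: (iffP sub_bigcapmxP) => [AU j|AU j _].
  by have /sub_kermxP := AU j isT; rewrite mulmxA.
by apply/sub_kermxP; rewrite mulmxA.
Qed.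

Lemma sub_perp_dual k i (A : 'M_(k, d i)) U :
  (A <= perp b U i)%MS = (A <= kermx (b i (iv sg i) *m (U (iv sg i))^T))%MS.
Proof.
have [_ off _ _] := sdm; apply/sub_perpP/sub_kermxP => [A0|A0 j].
  by rewrite mulmxA.
have [ij | ij] := eqVneq i (iv sg j); last by rewrite off // mulmx0 mul0mx.
by have -> : j = iv sg i; [rewrite ij iv_involutive|rewrite -mulmxA].
Qed.

Lemma subdim_perp U i : (subdim (perp b U) i + subdim U (iv sg i))%N = d i.
Proof.
have -> : subdim (perp b U) i =
  \rank (kermx (b i (iv sg i) *m (U (iv sg i))^T)).
  by apply: eqmx_rank; rewrite -sub_perp_dual submx_refl sub_perp_dual
    submx_refl.
rewrite mxrank_ker (eqmxMfull _ (selfdual_block_full i)) mxrank_tr subnK //.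
by rewrite -(selfdual_dim i) rank_leq_col.
Qed.

Lemma sub_perpC U V : sub_le U (perp b V) -> sub_le V (perp b U).
Proof.
move=> UV i; apply/sub_perpP => j.
have /sub_perpP/(_ i) := UV j; rewrite (selfdual_sym i j).
rewrite -scalemxAr -scalemxAl => /(congr1 trmx).
by rewrite !trmx_mul !trmxK trmx0 mulmxA => ->; rewrite scaler0.
Qed.

Lemma perpK U i : (perp b (perp b U) i <= U i)%MS.
Proof.
have sUpp : (U i <= perp b (perp b U) i)%MS.
  by apply: (@sub_perpC (perp b U) U) => j.
suff /andP[] : (U i == perp b (perp b U) i)%MS by [].
rewrite -(mxrank_leqif_eq sUpp); apply/eqP.
have := subdim_perp (perp b U) i; have := subdim_perp U (iv sg i).
rewrite iv_involutive selfdual_dim => dimU dimpU; apply/eqP.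
by rewrite -(eqn_add2l (subdim (perp b U) (iv sg i))) [X in X == _]dimU addnC
  dimpU.
Qed.

Lemma perp_subrep U : is_subrep m U -> is_subrep m (perp b U).
Proof.
move=> subU a; apply/sub_perpP => j; have [_ off _ _] := sdm.
have [ta | ta] := eqVneq (tgt a) (iv sg j);
  last by rewrite off // mulmx0 mul0mx.
have {ta j}-> : j = src (ia sg a) by rewrite src_ia ta iv_involutive.
rewrite -(mulmxA _ (m a)) selfdual_adj -scalemxAr -scalemxAl !mulmxA.
rewrite -[_ *m _^T *m _^T]mulmxA -trmx_mul.
have /submxP[C ->] := subU (ia sg a); rewrite trmx_mul mulmxA.
by have /sub_perpP -> := submx_refl (perp b U (src a)); rewrite mul0mx scaler0.
Qed.

Lemma isotropicP U : isotropic b U <-> sub_le U (perp b U).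
Proof.
split=> [isoU i | sUU i j x y xU yU].
  apply/sub_perpP => j; apply: eq_mx_pairing => x y.
  rewrite mulmx0 mul0mx [RHS]mxE -(isoU i j (x *m U i) (y *m U j)) ?submxMl //.
  by rewrite /bpair trmx_mul !mulmxA.
have /sub_perpP/(_ j) := submx_trans xU (sUU i); rewrite /bpair.
have /submxP[C ->] := yU => xU0.
by rewrite trmx_mul mulmxA xU0 mul0mx mxE.
Qed.

Lemma sub_le_perp U V : sub_le U V -> sub_le (perp b V) (perp b U).
Proof.
move=> UV i; apply/sub_perpP => j; have /submxP[C ->] := UV j.
rewrite trmx_mul mulmxA.
by have /sub_perpP -> := submx_refl (perp b V i); rewrite mul0mx.
Qed.

End SelfDualForms.

(** * The self-dual representation on the quotient of the orthogonal *)

Lemma block_nondegenerate (K : fieldType) (Q : quiver)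
    (sg : quiver_involution Q) (d : vert Q -> nat) (c : bform K d) :
    (forall i j, i != iv sg j -> c i j = 0) ->
    (forall i, row_free (c i (iv sg i))) -> nondegenerate_form c.
Proof.
move=> off free_c x x0 i; apply: (row_free_inj (free_c i)); rewrite mul0mx.
apply/rowP => k; rewrite [RHS]mxE.
pose y := dfwith (fun j => 0 : 'rV[K]_(d j)) (delta_mx 0 k : 'rV_(d (iv sg i))).
rewrite -(x0 y) (bigD1 i) //= (bigD1 (iv sg i)) //= big1 => [|j ji]; last first.
  by rewrite /bpair /y dfwith_out 1?eq_sym // trmx0 mulmx0 mxE.
rewrite big1 => [|l li]; last first.
  rewrite big1 // => j _; rewrite /bpair /y.
  have [<- | ij] := eqVneq (iv sg i) j;
    last by rewrite dfwith_out // trmx0 mulmx0 mxE.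
  by rewrite off ?iv_involutive // mulmx0 mul0mx mxE.
by rewrite !addr0 /bpair /y dfwith_in trmx_delta -colE !mxE.
Qed.

Section PairB.
Variables (K : fieldType) (Q : quiver) (d : vert Q -> nat) (b : bform K d).

Lemma bpairBl i j (x x' : 'rV_(d i)) (y : 'rV_(d j)) :
  bpair b (x - x') y = bpair b x y - bpair b x' y.
Proof. by rewrite /bpair !mulmxBl !mxE. Qed.

Lemma bpairBr i j (x : 'rV_(d i)) (y y' : 'rV_(d j)) :
  bpair b x (y - y') = bpair b x y - bpair b x y'.
Proof. by rewrite /bpair linearB /= mulmxBr !mxE. Qed.

End PairB.

Section SelfDualQuotient.
Variables (K : fieldType) (Q : quiver) (sg : quiver_involution Q).
Variables (D : duality_structure sg) (d : vert Q -> nat) (b : bform K d).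
Variable m : rep K d.
Hypothesis sdm : selfdual_rep D b m.
Variable U : subsp K d.
Hypotheses (subU : is_subrep m U) (isoU : isotropic b U).

Let UpU : sub_le U (perp b U). Proof. exact/(isotropicP b U). Qed.
Let L i := lift_subquot (perp b U) U i.

Lemma sdquotdimE i :
  (sdquotdim b U i + (subdim U i + subdim U (iv sg i)))%N = d i.
Proof. by rewrite addnA (subquotdimE UpU); apply: (subdim_perp sdm). Qed.

Let bpair_sub_perp i j (x : 'rV_(d i)) (y : 'rV_(d j)) :
  (x <= U i)%MS -> (y <= perp b U j)%MS -> bpair b x y = 0 /\ bpair b y x = 0.
Proof.
move=> xU yp; split.
  have /submxP[E ->] := yp; have xpp :=
    submx_trans xU (sub_perpC sdm (fun=> submx_refl _) i).
  by rewrite /bpair trmx_mul mulmxA; have /sub_perpP -> := xpp;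
    rewrite mul0mx mxE.
have /submxP[E ->] := xU; rewrite /bpair trmx_mul mulmxA.
by have /sub_perpP -> := yp; rewrite mul0mx mxE.
Qed.

Let bpair_lift i j x y :
  bpair (sdquot_form b U) x y = bpair b (x *m L i) (y *m L j).
Proof.
rewrite /bpair sdquot_formE -/(L i) -/(L j); move: (L i) (L j) => A B.
by rewrite trmx_mul !mulmxA.
Qed.

Let lift_perp i (x : 'rV_(sdquotdim b U i)) : (x *m L i <= perp b U i)%MS.
Proof. by apply: submx_trans (submxMl _ _) _; exact: lift_subquot_sub. Qed.

(** All four conditions are checked on lifts to the orthogonal of U, which is
    legitimate because U is orthogonal to its orthogonal. The induced form is
    nondegenerate because a lift that is orthogonal to all lifts is orthogonal
    to the whole of U^perp, hence lies in U by perpK. *)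
Lemma sdquot_selfdual : selfdual_rep D (sdquot_form b U) (sdquot_rep b m U).
Proof.
have [_ off sym adj] := sdm.
have offc i j : i != iv sg j -> sdquot_form b U i j = 0.
  by move=> ij; rewrite sdquot_formE off // mulmx0 mul0mx.
have hom a : (L (src a) *m m a - subquot_rep m (perp b U) U a *m L (tgt a) <=
  U (tgt a))%MS.
  exact: lift_subquot_hom (perp_subrep sdm subU) a.
have homl a (x : 'rV_(subquotdim (perp b U) U (src a))) j (w : 'rV_(d j)) :
    (w <= perp b U j)%MS ->
    bpair b (x *m subquot_rep m (perp b U) U a *m L (tgt a)) w =
      bpair b (x *m L (src a) *m m a) w /\
    bpair b w (x *m subquot_rep m (perp b U) U a *m L (tgt a)) =
      bpair b w (x *m L (src a) *m m a).
  move=> wp; have xU := submx_trans (submxMl x _) (hom a).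
  have [u0 u1] := bpair_sub_perp xU wp.
  move: u0 u1; rewrite mulmxBr !mulmxA bpairBl bpairBr.
  by move=> /subr0_eq -> /subr0_eq ->.
split=> //.
- apply: (@block_nondegenerate _ _ sg) => // i.
  rewrite -kermx_eq0; apply/eqP/(lift_subquot_inj UpU).
  apply: submx_trans (perpK sdm U i).
  set X := kermx _; have X0 : X *m sdquot_form b U i (iv sg i) =
    0 by rewrite mulmx_ker.
  rewrite (sub_perp_dual sdm) sub_kermx.
  have /sub_addsmxP[[E F] ->] := lift_subquot_span UpU (iv sg i).
  rewrite linearD /= !trmx_mul !mulmxDr mulmxA; apply/eqP.
  have Lp : (X *m L i <= perp b U i)%MS.
    by apply: submx_trans (submxMl _ _) _; exact: lift_subquot_sub.
  have /sub_perpP/(_ (iv sg i)) := Lp; rewrite !mulmxA => ->;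
    rewrite mul0mx add0r.
  by move: X0; rewrite sdquot_formE !mulmxA => ->; rewrite mul0mx.
- by move=> i x y; rewrite !bpair_lift sym.
move=> a x y; rewrite !bpair_lift.
rewrite [LHS](homl a x _ _ (lift_perp y)).1 adj; congr (_ * _).
exact/esym/(homl (ia sg a) y _ _ (lift_perp x)).2.
Qed.

End SelfDualQuotient.

(** * Uniqueness of self-dual structures *)

(** The roots are added one at a time, as in Hensel's lemma: if p ^+ 2 - 'X is a
    multiple of q, replace p by p + c q and choose c such that the new quotient
    vanishes at r. This is a quadratic equation for c, except when r is already
    a root of q; then it is linear with coefficient 2 p(r), which is nonzero as
    p(r) is a square root of r. *)
Lemma sqrtX_mod (K : numClosedFieldType) (rs : seq K) : 0 \notin rs ->
  exists p : {poly K}, \prod_(r <- rs) ('X - r%:P) %| p ^+ 2 - 'X.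
Proof.
elim: rs => [|r rs IHrs]; first by exists 0; rewrite big_nil dvd1p.
rewrite inE negb_or eq_sym => /andP[r0 /IHrs[p]].
set q := \prod_(r <- rs) _ => /dvdpP[h hE].
suff [c rc] : exists c, h.[r] + c * p.[r] *+ 2 + c ^+ 2 * q.[r] = 0.
  exists (p + c%:P * q); rewrite big_cons -/q.
  have -> : (p + c%:P * q) ^+ 2 - 'X = (h + c%:P * p *+ 2 + c%:P ^+ 2 * q) * q.
    transitivity ((p ^+ 2 - 'X) + (c%:P * p *+ 2 + c%:P ^+ 2 * q) * q);
      first by ring.
    by rewrite hE; ring.
  apply: dvdp_mul => //; rewrite dvdp_XsubCl /root -rc.
  by rewrite !hornerD !hornerM hornerC.
have [q0|q0] := eqVneq q.[r] 0.
  have pr : p.[r] != 0.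
    have : (p ^+ 2 - 'X).[r] = 0 by rewrite hE hornerM q0 mulr0.
    rewrite !hornerE => /subr0_eq pr2; apply: contraNneq r0 => pr0.
    by rewrite -pr2 pr0 expr0n.
  by exists (- h.[r] / (p.[r] *+ 2)); rewrite q0; field; rewrite pr.
pose c := sqrtC (p.[r] ^+ 2 - h.[r] * q.[r]).
exists ((c - p.[r]) / q.[r]);
  transitivity ((c ^+ 2 - (p.[r] ^+ 2 - h.[r] * q.[r])) / q.[r]).
  by field; rewrite q0.
by rewrite sqrtCK subrr mul0r.
Qed.

Section PolyMatrix.
Variable K : comNzRingType.

(** The ring structure on matrices, hence horner_mx, requires positive size. *)
Definition poly_mx n (p : {poly K}) : 'M[K]_n -> 'M[K]_n :=
  if n is n'.+1 then fun A => horner_mx A p else id.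

Lemma poly_mx_intertwine n k p (A : 'M_n) (B : 'M_k) (C : 'M_(n, k)) :
  C *m B = A *m C -> C *m poly_mx p B = poly_mx p A *m C.
Proof.
case: n A C => [|n] A C; first by move=> _; rewrite [LHS]flatmx0 [RHS]flatmx0.
case: k B C => [|k] B C; first by move=> _; rewrite [LHS]thinmx0 [RHS]thinmx0.
move=> CB /=; elim/poly_ind: p => [|p c IHp];
  first by rewrite !rmorph0 mulmx0 mul0mx.
rewrite !rmorphD !rmorphM /= !horner_mx_X !horner_mx_C mulmxDr mulmxDl
  -scalar_mxC.
by congr (_ + _); rewrite [LHS]mulmxA IHp -[RHS]mulmxA -CB mulmxA.
Qed.

Lemma tr_poly_mx n p (A : 'M_n) : (poly_mx p A)^T = poly_mx p A^T.
Proof.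
case: n A => [|n] A //=; elim/poly_ind: p => [|p c IHp];
  first by rewrite !rmorph0 trmx0.
rewrite !rmorphD !rmorphM /= !horner_mx_X !horner_mx_C linearD /= tr_scalar_mx.
congr (_ + _); rewrite [LHS]trmx_mul IHp.
by rewrite -[RHS](@poly_mx_intertwine n.+1 n.+1 p A^T A^T A^T).
Qed.

Lemma poly_mx_sqr n (p q : {poly K}) (A : 'M_n) :
  p ^+ 2 - 'X = q * char_poly A -> poly_mx p A *m poly_mx p A = A.
Proof.
case: n A => [|n] A E; first by rewrite [LHS]flatmx0 [RHS]flatmx0.
have := congr1 (horner_mx A) E.
rewrite rmorphB rmorphXn rmorphM /= Cayley_Hamilton mulr0 horner_mx_X =>
  /subr0_eq pA.
by rewrite -[RHS]pA expr2.
Qed.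

End PolyMatrix.

Lemma char_poly_unit_root (K : fieldType) n (A : 'M[K]_n) : A \in unitmx ->
  ~~ root (char_poly A) 0.
Proof.
move=> uA; rewrite -eigenvalue_root_char; apply/eigenvalueP => -[v vA].
apply/negP; rewrite negbK -[v](mulmxK uA) vA scale0r mul0mx.
by [].
Qed.

Section Isometry.
Variables (K : numClosedFieldType) (Q : quiver) (sg : quiver_involution Q).
Variables (D : duality_structure sg) (d : vert Q -> nat).

(** The matrix X = c^-1 b comparing two forms is self-adjoint for c. So is
    every polynomial in X, in particular a p(X) with p(X)^2 = X, and thus
    p(X)^T c p(X) = c p(X)^2 = c X = b. The same p has to serve at i and at
    iv i; it is taken modulo the product of all the characteristic polynomials,
    which does not vanish at 0. *)
Lemma exists_isometry (b c : bform K d) (m n : rep K d) :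
    selfdual_rep D b m -> selfdual_rep D c n ->
  exists g : forall i, 'M[K]_(d i), forall i j, g i *m c i j *m (g j)^T = b i j.
Proof.
move=> sdb sdc.
have inv (c' : bform K d) n' : selfdual_rep D c' n' -> forall i j, i =
  iv sg j ->
    c' i j *m pinvmx (c' i j) = 1%:M /\ pinvmx (c' i j) *m c' i j = 1%:M.
  move=> sd' i j ij; have -> : j = iv sg i by rewrite ij iv_involutive.
  by rewrite mulmxVp ?(selfdual_block_free sd') // mulVpmx //
    (selfdual_block_full sd').
pose X i j : 'M_(d j) := pinvmx (c i j) *m b i j.
have unitX i j : i = iv sg j -> X i j \in unitmx.
  move=> ij; have [bV Vb] := inv _ _ sdb i j ij; have [cV Vc] :=
    inv _ _ sdc i j ij.
  suff /mulmx1_unit[] : X i j *m (pinvmx (b i j) *m c i j) = 1%:M by [].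
  by rewrite /X -mulmxA (mulmxA (b i j)) bV mul1mx.
pose F : {poly K} := \prod_j char_poly (X (iv sg j) j).
have [rs FE] := closed_field_poly_normal F.
have monicF : F \is monic by apply: monic_prod => j _; apply: char_poly_monic.
rewrite (monicP monicF) scale1r in FE.
have rs0 : 0 \notin rs.
  rewrite -root_prod_XsubC -FE /root horner_prod prodf_seq_neq0.
  by apply/allP => j _; apply/char_poly_unit_root/unitX.
have [p /dvdpP[q pE]] := sqrtX_mod rs0.
have sqrX i j : i = iv sg j -> poly_mx p (X i j) *m poly_mx p (X i j) = X i j.
  move=> ->; apply: (@poly_mx_sqr _ _ _
    (q * \prod_(k | k != j) char_poly (X (iv sg k) k))).
  by rewrite pE -FE /F (bigD1 j) //= mulrCA mulrC.
exists (fun j => (poly_mx p (X (iv sg j) j))^T) => i j; rewrite trmxK.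
have [_ offb _ _] := sdb; have [_ offc _ _] := sdc.
have [ij | ij] := eqVneq i (iv sg j);
  last by rewrite offc // offb // mulmx0 mul0mx.
have ji : j = iv sg i by rewrite ij iv_involutive.
have [cV Vc] := inv _ _ sdc i j ij; have [cV' Vc'] := inv _ _ sdc j i ji.
have cX : c i j *m X i j = b i j by rewrite /X mulmxA cV mul1mx.
have swap : c i j *m X i j = (X j i)^T *m c i j.
  rewrite cX /X trmx_mul (selfdual_sym sdc i j) -scalemxAr -mulmxA -trmx_mul
    cV'.
  by rewrite trmx1 mulmx1 -(selfdual_sym sdb).
rewrite -ij -ji tr_poly_mx -(poly_mx_intertwine p swap) -mulmxA.
by rewrite sqrX.
Qed.

Variables (b c : bform K d) (n : rep K d).
Hypotheses (sdb : selfdual_form D b) (sdn : selfdual_rep D c n).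

Lemma isometry_transport (theta : stability Q) : sigma_semistable theta c n ->
  exists n' : rep K d, selfdual_rep D b n' /\ sigma_semistable theta b n'.
Proof.
move=> ssn; have [g gE] := exists_isometry sdb sdn.
have [nondeg offb symb _] := sdb.
have ug i : g i \in unitmx.
  rewrite -row_free_unit -row_leq_rank
    -[X in (X <= _)%N](eqP (selfdual_block_free sdb i)).
  by rewrite -gE -mulmxA mxrankM_maxl.
have [n' n'g] : exists n' : rep K d, forall a, n' a *m g (tgt a) =
  g (src a) *m n a.
  by exists (fun a => g (src a) *m n a *m invmx (g (tgt a))) => a;
    rewrite mulmxKV.
have adj' a : n' a *m b (tgt a) (src (ia sg a)) =
    (dtau D a)%:~R *: (b (src a) (tgt (ia sg a)) *m (n' (ia sg a))^T).
  rewrite -!gE !mulmxA n'g -(mulmxA _ (n a)) (selfdual_adj sdn).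
  rewrite -(mulmxA _ _ (n' _)^T) -trmx_mul n'g trmx_mul !mulmxA.
  by rewrite -scalemxAr -scalemxAl !mulmxA.
exists n'; split.
  split=> // a x y; rewrite /bpair -(mulmxA x) adj' -scalemxAr -scalemxAl
    [LHS]mxE.
  by congr (_ * _); rewrite trmx_mul !mulmxA.
move=> X subX isoX [i0 nzX].
have dimX : subdim (fun i => <<X i *m g i>>%MS : 'M[K]_(d i)) =1 subdim X.
  by move=> i; rewrite /subdim genmxE mxrankMfree // row_free_unit.
have -> : subdim X = subdim (fun i => <<X i *m g i>>%MS : 'M[K]_(d i)).
  by apply: funext => i; rewrite dimX.
apply: ssn.
- move=> a; rewrite genmxE (eqmxMr _ (genmxE _)) -mulmxA -n'g mulmxA.
  by rewrite submxMr.
- apply/isotropicP => i; rewrite genmxE; apply/sub_perpP => j.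
  have /isotropicP/(_ i)/sub_perpP/(_ j) := isoX.
  rewrite -gE !mulmxA => X0.
  have /submxP[E ->] : (<<X j *m g j>> <= X j *m g j)%MS by rewrite genmxE.
  by rewrite !trmx_mul !mulmxA X0 mul0mx.
exists i0; rewrite -mxrank_eq0.
by rewrite [X in X != _]dimX mxrank_eq0.
Qed.

End Isometry.

(** * Increasing part of the upper convex hull of a finite set of points *)

Section Hull.
Variables (F : finType) (pt : pred F) (x y : F -> rat).

Definition chord p q : rat := (y q - y p) / (x q - x p).

(** The strict inequality makes q the right end of an edge of the hull, not just
    a point on it; this is why the slopes of consecutive edges decrease
    strictly. *)
Definition hull_edge p q : Prop :=
  [/\ pt q, x p < x q, 0 < chord p q &
    forall w, pt w -> y w - y p <= chord p q * (x w - x p) /\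
      (x q < x w -> y w - y p < chord p q * (x w - x p))].

Fixpoint hull_path p s : Prop :=
  if s is q :: s' then hull_edge p q /\ hull_path q s' else True.

Lemma chordE p q : x p < x q -> chord p q * (x q - x p) = y q - y p.
Proof. by move=> pq; rewrite /chord divfK // subr_eq0 gt_eqF. Qed.

Lemma hull_edge_pt p q w : hull_edge p q -> pt w ->
  y w - y q <= chord p q * (x w - x q) /\
  (x q < x w -> y w - y q < chord p q * (x w - x q)).
Proof.
move=> [_ pq _ max] /max[le lt]; have E := chordE pq.
by split=> [|/lt {}lt]; lra.
Qed.

Lemma hull_edge_chord p q w : hull_edge p q -> hull_edge q w ->
  chord q w < chord p q.
Proof.
move=> pq [ptw qw _ _]; have [_ /(_ qw)] := hull_edge_pt pq ptw.
by rewrite -(chordE qw) ltr_pM2r // subr_gt0.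
Qed.

(** This is what has to be known about the points to the left of p in order to
    continue the hull from p by its steepest increasing chord. *)
Definition left_of_hull p : Prop :=
  [/\ pt p,
      forall w q, pt w -> pt q -> x w <= x p -> x p < x q -> 0 < chord p q ->
        y w - y p <= chord p q * (x w - x p)
    & forall w, pt w -> (x w <= x p -> y w <= y p) /\ (x w < x p -> y w < y p)].

Lemma hull_edge_left p q : hull_edge p q -> left_of_hull q.
Proof.
move=> pq; have [ptq ltpq gt0 _] := pq; split=> // [w v ptw ptv wq qv _|w ptw].
  have [le _] := hull_edge_pt pq ptw; have [_ /(_ qv)] := hull_edge_pt pq ptv.
  rewrite -(chordE qv) ltr_pM2r ?subr_gt0 // => lt.
  by apply: le_trans le _; nra.
by have [le _] := hull_edge_pt pq ptw; split=> wq; nra.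
Qed.

Lemma exists_hull_edge p q0 : left_of_hull p -> pt q0 -> x p < x q0 ->
  y p < y q0 ->
  exists q, hull_edge p q.
Proof.
move=> [ptp leftp _] ptq0 pq0 ypq0.
pose C q := pt q && (x p < x q).
have Cq0 : C q0 by rewrite /C ptq0.
(* Among the steepest chords from p, the longest one is an edge. *)
have [q1 /andP[ptq1 pq1] max1] :=
  @Order.TotalTheory.arg_maxP _ rat F q0 C (chord p) Cq0.
have gt0 : 0 < chord p q1.
  by apply: lt_le_trans (max1 q0 Cq0); rewrite divr_gt0 // subr_gt0.
pose C' q := C q && (chord p q == chord p q1).
have C'q1 : C' q1 by rewrite /C' /C ptq1 pq1 eqxx.
have [q /andP[/andP[ptq pq] /eqP slq] max2] :=
  @Order.TotalTheory.arg_maxP _ rat F q1 C' x C'q1.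
exists q; split=> //; rewrite slq // => w ptw.
have [wp | pw] := leP (x w) (x p).
  split; last by move=> qw; have := lt_le_trans (lt_trans pq qw) wp;
    rewrite ltxx.
  by rewrite -slq; apply: leftp; rewrite ?slq.
have Cw : C w by rewrite /C ptw.
rewrite -(chordE pw) ler_pM2r ?ltr_pM2r ?subr_gt0 //; split; first exact: max1.
move=> qw; rewrite lt_neqAle [_ <= _](max1 w Cw) andbT; apply/negP => slw.
by have := max2 w; rewrite /C' Cw slw => /(_ isT) /=; rewrite leNgt qw => /negP.
Qed.

Lemma exists_hull p : left_of_hull p ->
  exists s, hull_path p s /\
    forall w, pt w ->
      y w <= y (last p s) /\ (x w < x (last p s) -> y w < y (last p s)).
Proof.
have [n] := ubnP #|[pred q | pt q & x p < x q]|.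
elim: n p => // n IHn p /ltnSE-card_n leftp.
have [[q0 [ptq0 pq0 ypq0]]|noq] :=
    pselect (exists q, [/\ pt q, x p < x q & y p < y q]); last first.
  exists [::]; split=> //= w ptw; have [_ _ /(_ w ptw)[le lt]] := leftp.
  split=> //; have [/le//|pw] := leP (x w) (x p).
  by rewrite leNgt; apply/negP => pyw; apply: noq; exists w.
have [q pq] := exists_hull_edge leftp ptq0 pq0 ypq0.
have [ptq ltpq _ _] := pq; have [|s [hs lasts]] := IHn q _ (hull_edge_left pq).
  apply: leq_trans card_n; apply: proper_card; apply/properP; split.
    by apply/subsetP => w; rewrite !inE => /andP[-> /(lt_trans ltpq)].
  by exists q; rewrite !inE ptq ?ltpq // ltxx.
by exists (q :: s).
Qed.

Lemma hull_path_nth p s p0 k : hull_path p s -> (k < size s)%N ->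
  hull_edge (nth p0 (p :: s) k) (nth p0 (p :: s) k.+1).
Proof. by elim: s p k => [|q s IHs] p [|k] //= [pq /IHs]; auto. Qed.

End Hull.

(** * Hull of the subrepresentations in the plane of dimension and theta *)

Section Defect.
Variables (Q : quiver) (theta : stability Q).
Implicit Types f g h : vert Q -> nat.

(** The height of the point (dim f, theta f) above the line of slope mu through
    the origin; it compares slopes additively. *)
Definition defect (mu : rat) f : rat :=
  (theta_dim theta f)%:~R - mu * (dimtot f)%:R.

Lemma dimtotD f g h : (forall i, h i = (f i + g i)%N) ->
  dimtot h = (dimtot f + dimtot g)%N.
Proof. by move=> hE; rewrite /dimtot -big_split; apply: eq_bigr => i _. Qed.

Lemma theta_dimD f g h : (forall i, h i = (f i + g i)%N) ->
  theta_dim theta h = theta_dim theta f + theta_dim theta g.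
Proof.
move=> hE; rewrite /theta_dim -raddfD; congr (theta _); apply/ffunP => i.
by rewrite !ffunE hE PoszD.
Qed.

Lemma defectD mu f g h : (forall i, h i = (f i + g i)%N) ->
  defect mu h = defect mu f + defect mu g.
Proof.
move=> hE; rewrite /defect (dimtotD hE) (theta_dimD hE) rmorphD natrD /=; ring.
Qed.

Lemma eq_dimtot f g : f =1 g -> dimtot f = dimtot g.
Proof. by move=> fg; apply: eq_bigr => i _. Qed.

Lemma eq_theta_dim f g : f =1 g -> theta_dim theta f = theta_dim theta g.
Proof. by move=> fg; congr (theta _); apply/ffunP => i; rewrite !ffunE fg. Qed.

Lemma eq_defect mu f g : f =1 g -> defect mu f = defect mu g.
Proof. by move=> fg; rewrite /defect (eq_dimtot fg) (eq_theta_dim fg). Qed.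

Lemma dimtot_gt0 f i : f i != 0%N -> (0 < dimtot f)%N.
Proof. by move=> fi; rewrite /dimtot (bigD1 i) //= addn_gt0 lt0n fi. Qed.

Lemma dimtot_eq f g : (forall i, f i <= g i)%N -> (dimtot g <= dimtot f)%N ->
  f =1 g.
Proof.
move=> fg tot i; apply/eqP; rewrite eqn_leq fg /= leqNgt; apply/negP => lt_fg.
move: tot; rewrite leqNgt /dimtot (bigD1 i) //= [X in (_ < X)%N](bigD1 i) //=.
by rewrite -addSn leq_add // leq_sum.
Qed.

Lemma slope_le mu f : (0 < dimtot f)%N -> (slope theta f <= mu) =
  (defect mu f <= 0).
Proof.
by move=> f0; rewrite /slope /defect ler_pdivrMr ?ltr0n // subr_le0.
Qed.

Lemma slope_eq mu f : (0 < dimtot f)%N -> defect mu f = 0 -> slope theta f = mu.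
Proof.
move=> f0 /subr0_eq E; rewrite /slope E mulfK // pnatr_eq0; lia.
Qed.

End Defect.

Section HNFiltration.
Variables (K : fieldType) (Q : quiver) (theta : stability Q).
Variables (d : vert Q -> nat) (m : rep K d).

Definition zero_sub : subsp K d := fun i => 0.

Lemma zero_subrep : is_subrep m zero_sub.
Proof. by move=> a; rewrite mul0mx sub0mx. Qed.

Let F : finType := {ffun vert Q -> 'I_(dimtot d).+1}.
Let pt (p : F) := `[< exists U, is_subrep m U /\
  subdim U =1 (fun i => p i : nat) >].
Let x (p : F) : rat := (dimtot (fun i => p i : nat))%:R.
Let y (p : F) : rat := (theta_dim theta (fun i => p i : nat))%:~R.

Let code (U : subsp K d) : F := [ffun i => inord (subdim U i)].

Let codeE U i : code U i = subdim U i :> nat.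
Proof.
rewrite ffunE inordK // ltnS (leq_trans (rank_leq_row _)) //.
by rewrite /dimtot (bigD1 i) //= leq_addr.
Qed.

Let pt_code U : is_subrep m U -> pt (code U).
Proof.
by move=> subU; apply/asboolP; exists U; split=> // i; rewrite codeE.
Qed.

Let xE U : x (code U) = (dimtot (subdim U))%:R.
Proof. by congr _%:R; apply: eq_dimtot => i; rewrite codeE. Qed.

Let yE U : y (code U) = (theta_dim theta (subdim U))%:~R.
Proof. by congr _%:~R; apply: eq_theta_dim => i; rewrite codeE. Qed.

Definition theta_maximal mu (U : subsp K d) : Prop :=
  forall W, is_subrep m W -> defect theta mu (subdim W) <=
    defect theta mu (subdim U).

(** The defect is additive, so the sum of U and V is again a maximiser; as V has
    the largest dimension among the maximisers, it is equal to the sum. *)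
Lemma theta_maximal_sub mu U V : is_subrep m U -> is_subrep m V ->
    theta_maximal mu U -> theta_maximal mu V ->
    (forall W, is_subrep m W -> (dimtot (subdim V) < dimtot (subdim W))%N ->
      defect theta mu (subdim W) < defect theta mu (subdim V)) ->
  sub_le U V.
Proof.
move=> subU subV maxU maxV topV.
have subS := add_subrep subU subV; have subC := cap_subrep subU subV.
have E : defect theta mu (subdim (add_sub U V)) + defect theta mu
  (subdim (cap_sub U V))
    = defect theta mu (subdim U) + defect theta mu (subdim V).
  rewrite -(defectD _ _ (fun i => erefl (subdim U i + subdim V i)%N)).
  by rewrite -(defectD _ _ (h := fun i => (subdim U i + subdim V i)%N)) // => i;
    rewrite subdim_add_cap.
have VS i : (V i <= add_sub U V i)%MS by apply: addsmxSr.
have le i : (subdim V i <= subdim (add_sub U V) i)%N by apply: mxrankS.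
have ge : (dimtot (subdim (add_sub U V)) <= dimtot (subdim V))%N.
  rewrite leqNgt; apply/negP => /(topV _ subS); have := maxU _ subC; lra.
move=> i; have := dimtot_eq le ge i => dimE.
have : (add_sub U V i <= V i)%MS.
  by move: (mxrank_leqif_eq (VS i)) => [_]; rewrite [X in X == _]dimE eqxx =>
    /esym/andP[].
exact: submx_trans (addsmxSl _ _).
Qed.

(** The U k attain the vertices of the increasing part of the hull, and mu k is
    the slope of the edge from U k to U k.+1. The last U r is a maximiser of
    theta, and of least dimension among these because all the edges that lead
    to it have positive slope. *)
Lemma exists_HN_filtration :
  exists (r : nat) (U : nat -> subsp K d) (mu : nat -> rat),
    [/\ forall i, U 0%N i = 0,
        forall k, (k <= r)%N -> is_subrep m (U k),
        forall k, (k < r)%N -> [/\ sub_le (U k) (U k.+1),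
          (dimtot (subdim (U k)) < dimtot (subdim (U k.+1)))%N, 0 < mu k,
          theta_maximal (mu k) (U k) & theta_maximal (mu k) (U k.+1)],
        forall k, (k.+1 < r)%N -> mu k.+1 < mu k
      & theta_maximal 0 (U r) /\
        forall W, is_subrep m W -> (dimtot (subdim W) <
          dimtot (subdim (U r)))%N ->
          defect theta 0 (subdim W) < defect theta 0 (subdim (U r))].
Proof.
pose p0 := code zero_sub.
have x0 : x p0 = 0.
  by rewrite xE; apply/eqP; rewrite pnatr_eq0 /dimtot big1 // => i _;
    rewrite /subdim mxrank0.
have y0 w : x w <= 0 -> y w = 0.
  rewrite /x lern0 => /eqP w0.
  have w_0 i : w i = 0%N :> nat.
    by apply/eqP; apply: contraTT isT => /(@dimtot_gt0 _ (fun i => w i : nat));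
      rewrite w0.
  rewrite /y /theta_dim (_ : [ffun i => _] = 0) ?raddf0 //.
  by apply/ffunP => i; rewrite !ffunE w_0.
have yp0 : y p0 = 0 by apply: y0; rewrite x0.
have xge0 w : 0 <= x w by rewrite ler0n.
have left0 : left_of_hull pt x y p0.
  split=> [|w q _ _|w _]; first exact/pt_code/zero_subrep.
    rewrite x0 => wle0; have -> : x w = 0 by apply/eqP; rewrite eq_le wle0 xge0.
    by rewrite y0 // yp0 !subrr mulr0.
  by rewrite x0; split=> [/y0->|]; [rewrite yp0|rewrite ltNge xge0].
have [s [hs maxs]] := exists_hull left0.
have ptn k : (k <= size s)%N -> pt (nth p0 (p0 :: s) k).
  case: k => [|k] ks; first exact/pt_code/zero_subrep.
  by have [] := hull_path_nth p0 hs ks.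
have chooseU k : exists U, (k <= size s)%N ->
    is_subrep m U /\ subdim U =1 (fun i => nth p0 (p0 :: s) k i : nat).
  have [ks|ks] := leqP k (size s); last by exists zero_sub.
  by have /asboolP[U UE] := ptn k ks; exists U.
have [U UE] := choice chooseU.
pose p k := nth p0 (p0 :: s) k.
pose mu k := chord x y (p k) (p k.+1).
have pE k : (k <= size s)%N -> p k = code (U k).
  by move=> ks; apply/ffunP => i; apply: val_inj; rewrite /= codeE (UE k ks).2.
have edge k : (k < size s)%N -> hull_edge pt x y (code (U k)) (code (U k.+1)).
  by move=> ks; rewrite -!pE ?(ltnW ks) //; apply: hull_path_nth.
have muE k : (k < size s)%N -> mu k = chord x y (code (U k)) (code (U k.+1)).
  by move=> ks; rewrite /mu !pE // ltnW.
have max1 k : (k < size s)%N -> theta_maximal (mu k) (U k).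
  move=> ks W subW; have [_ _ _ /(_ _ (pt_code subW))[le _]] := edge k ks.
  by move: le; rewrite -muE // /defect !xE !yE; lra.
have max2 k : (k < size s)%N -> theta_maximal (mu k) (U k.+1) /\
    (forall W, is_subrep m W -> (dimtot (subdim (U k.+1)) <
      dimtot (subdim W))%N ->
      defect theta (mu k) (subdim W) < defect theta (mu k) (subdim (U k.+1))).
  move=> ks; split=> W subW; have := hull_edge_pt (edge k ks) (pt_code subW);
    rewrite -muE // /defect !xE !yE.
    by case=> le _; lra.
  by case=> _; rewrite ltr_nat => lt /lt; lra.
have lastE : last p0 s = code (U (size s)) by rewrite -pE // /p nth_last.
exists (size s), U, mu; split.
- move=> i; apply/eqP; rewrite -mxrank_eq0; apply/eqP.
  by have [_ /(_ i)] := UE 0%N (leq0n _); rewrite /subdim => -> /=;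
    rewrite codeE /subdim mxrank0.
- by move=> k /UE[].
- move=> k ks; have [_ ltx gt0 _] := edge k ks; have [max' top'] := max2 k ks.
  split=> //; last by exact: max1.
  - have subUk := (UE k (ltnW ks)).1; have subUk1 := (UE k.+1 ks).1.
    exact: (theta_maximal_sub subUk subUk1 (max1 k ks) max' top').
  - by move: ltx; rewrite !xE ltr_nat.
  - by rewrite muE.
- move=> k ks; rewrite !muE ?(ltnW ks) //.
  by apply: (hull_edge_chord (edge k (ltnW ks)) (edge k.+1 ks)).
split=> W subW; have := maxs _ (pt_code subW); rewrite lastE /defect !xE !yE.
  by case=> le _; rewrite !mul0r !subr0.
by rewrite ltr_nat !mul0r !subr0 => -[].
Qed.

End HNFiltration.

(** * Duality on the hull *)

Section Duality.
Variables (Q : quiver) (sg : quiver_involution Q) (theta : stability Q).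
Hypothesis htheta : sigma_compatible sg theta.
Implicit Types f g : vert Q -> nat.

Lemma dimtot_iv f : dimtot (fun i => f (iv sg i)) = dimtot f.
Proof. by rewrite /dimtot [RHS](reindex_inj (inv_inj (iv_involutive sg))). Qed.

Lemma theta_dim_iv f : theta_dim theta (fun i => f (iv sg i)) =
  - theta_dim theta f.
Proof.
rewrite /theta_dim -htheta; congr (theta _); apply/ffunP => i.
by rewrite !ffunE.
Qed.

Lemma theta_dim_selfdual f : (forall i, f (iv sg i) = f i) ->
  theta_dim theta f = 0.
Proof.
move=> fE; have := theta_dim_iv f; rewrite (eq_theta_dim _ fE); lia.
Qed.

Variables (K : fieldType) (D : duality_structure sg) (d : vert Q -> nat).
Variables (b : bform K d).
Variable m : rep K d.
Hypothesis sdm : selfdual_rep D b m.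

Lemma defect_perp mu (U : subsp K d) :
  defect theta mu (subdim (perp b U)) =
  defect theta (- mu) (subdim U) - mu * (dimtot d)%:R.
Proof.
have dimE i : d i = (subdim (perp b U) i + subdim U (iv sg i))%N.
  by rewrite (subdim_perp sdm).
have := defectD theta mu dimE; rewrite /defect dimtot_iv theta_dim_iv.
by rewrite (theta_dim_selfdual (selfdual_dim sdm)) rmorphN /= => ?; lra.
Qed.

(** Taking orthogonals is an order reversing bijection on subrepresentations
    which changes the defect for mu into the one for - mu, up to a constant. *)
Lemma theta_maximal_perp mu (U : subsp K d) :
  theta_maximal theta m mu U -> theta_maximal theta m (- mu) (perp b U).
Proof.
move=> maxU W subW; have := maxU _ (perp_subrep sdm subW).
by rewrite !defect_perp opprK; lra.
Qed.

(** The orthogonal of U also maximises theta, hence so does its intersection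
    with U, by additivity of theta. As U has the least dimension among the
    maximisers, it is equal to this intersection. *)
Lemma maximal_isotropic (U : subsp K d) : is_subrep m U ->
    theta_maximal theta m 0 U ->
    (forall W, is_subrep m W -> (dimtot (subdim W) < dimtot (subdim U))%N ->
       defect theta 0 (subdim W) < defect theta 0 (subdim U)) ->
  isotropic b U.
Proof.
move=> subU maxU minU; apply/isotropicP.
have subp := perp_subrep sdm subU.
have subS := add_subrep subU subp; have subC := cap_subrep subU subp.
have sCU i : (cap_sub U (perp b U) i <= U i)%MS by apply: capmxSl.
have le i : (subdim (cap_sub U (perp b U)) i <= subdim U i)%N by apply: mxrankS.
have ge : (dimtot (subdim U) <= dimtot (subdim (cap_sub U (perp b U))))%N.
  rewrite leqNgt; apply/negP => /(minU _ subC).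
  have := defectD theta 0 (fun i => esym (subdim_add_cap U (perp b U) i)).
  rewrite (defectD _ _ (fun i => erefl (subdim U i + subdim (perp b U) i)%N)).
  by rewrite defect_perp oppr0 mul0r; have := maxU _ subS; lra.
move=> i; have dimE := dimtot_eq le ge i.
have : (U i <= cap_sub U (perp b U) i)%MS.
  by move: (mxrank_leqif_eq (sCU i)) => [_]; rewrite [X in X == _]dimE eqxx =>
    /esym/andP[].
by move=> /submx_trans; apply; apply: capmxSr.
Qed.

End Duality.

Lemma sorted_gt_rcons0 (f : nat -> rat) r :
    (forall k, (k < r)%N -> 0 < f k) ->
    (forall k, (k.+1 < r)%N -> f k.+1 < f k) ->
  sorted >%R (rcons [seq f k | k <- iota 0 r] 0).
Proof.
move=> pos dec; apply/(sortedP 0) => k;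
  rewrite size_rcons size_map size_iota ltnS => kr.
rewrite !nth_rcons size_map size_iota kr (nth_map 0%N) ?size_iota // nth_iota //
  add0n.
have [kr1|rk|_] := ltngtP k.+1 r;
  first by rewrite (nth_map 0%N) ?size_iota ?nth_iota //= dec.
  by move: rk; rewrite ltnS leqNgt kr.
exact: pos.
Qed.

(** * The polygon of a type *)

Section HNPath.
Variables (Q : quiver) (sg : quiver_involution Q) (t : hn_data Q).

Definition path_dim k (i : vert Q) : nat :=
  (\sum_(d <- take k (hn_path sg t)) (d : dimvec Q) i)%N.

Lemma path_dim_left k i : (k <= size t.1)%N ->
  path_dim k i = (\sum_(d <- take k t.1) (d : dimvec Q) i)%N.
Proof. by move=> kr; rewrite /path_dim /hn_path takel_cat. Qed.

(** In the right half of the path it is easier to count what remains: the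
    vertices k and 2 r + 1 - k are exchanged by duality. *)
Lemma path_dim_right k i : (k <= size t.1)%N ->
  (path_dim ((size t.1).*2.+1 - k) i +
     \sum_(d <- take k t.1) (d : dimvec Q) (iv sg i))%N
  = hn_weight sg t i.
Proof.
move=> kr; rewrite /path_dim /hn_path take_cat ifN;
  last by rewrite -leqNgt -addnn; lia.
have -> : ((size t.1).*2.+1 - k - size t.1 = (size t.1 - k).+1)%N
  by rewrite -addnn; lia.
rewrite /= take_rev size_map subKn // big_cat big_cons /=.
rewrite (perm_big _ (permEl (perm_rev _))) /= -map_drop big_map.
have sum_sdual s : (\sum_(d <- s) sdual sg d i =
  \sum_(d <- s) (d : dimvec Q) (iv sg i))%N.
  by apply: eq_bigr => d _; rewrite ffunE.
rewrite ffunE big_split /= !sum_sdual.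
pose g (d : dimvec Q) := d (iv sg i).
have -> : (\sum_(d <- t.1) g d =
  \sum_(d <- take k t.1) g d + \sum_(d <- drop k t.1) g d)%N.
  by rewrite -big_cat cat_take_drop.
by rewrite /g; lia.
Qed.

End HNPath.

Section EqDim.
Variables (K : fieldType) (Q : quiver) (theta : stability Q).
Implicit Types f g : vert Q -> nat.

Lemma eq_slope f g : f =1 g -> slope theta f = slope theta g.
Proof. by move=> fg; rewrite /slope (eq_dimtot fg) (eq_theta_dim _ fg). Qed.

Lemma semistable_eq_dim f g (m : rep K f) : f =1 g -> semistable theta m ->
  exists m' : rep K g, semistable theta m'.
Proof. by move=> /funext E; case: _ / E; exists m. Qed.

End EqDim.

Section PathSubreps.
Variables (K : fieldType) (Q : quiver) (sg : quiver_involution Q).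
Variables (D : duality_structure sg) (e : dimvec Q) (b : bform K e).
Variable m : rep K e.
Hypothesis sdm : selfdual_rep D b m.
Variables (t : hn_data Q) (U : nat -> subsp K e).
Hypotheses (weight_t : hn_weight sg t = e) (U0 : forall i, U 0%N i = 0).
Hypothesis subU : forall k, (k <= size t.1)%N -> is_subrep m (U k).
Hypothesis leU : forall k, (k < size t.1)%N -> sub_le (U k) (U k.+1).
Hypothesis dimU : forall k, (k < size t.1)%N ->
  subquotdim (U k.+1) (U k) =1 nth [ffun=> 0%N] t.1 k.

(** The filtration continued by the orthogonals of its members. *)
Definition path_sub k : subsp K e :=
  if (k <= size t.1)%N then U k else perp b (U ((size t.1).*2.+1 - k)).

Lemma path_sub_subrep k : is_subrep m (path_sub k).
Proof.
rewrite /path_sub; case: ifP => [|/negbT]; first exact: subU.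
rewrite -ltnNge => rk; apply: (perp_subrep sdm); apply: subU.
by rewrite -addnn; lia.
Qed.

Lemma subdim_take k i : (k <= size t.1)%N ->
  subdim (U k) i = (\sum_(d <- take k t.1) (d : dimvec Q) i)%N.
Proof.
elim: k => [|k IHk] kr; first by rewrite take0 big_nil /subdim U0 mxrank0.
rewrite (take_nth [ffun=> 0%N]) // big_rcons /= -(subquotdimE (leU kr)) dimU //.
by rewrite IHk ?(ltnW kr) // addnC.
Qed.

Lemma subdim_path_sub k : (k <= (size t.1).*2.+1)%N ->
  subdim (path_sub k) =1 path_dim sg t k.
Proof.
move=> kn i; rewrite /path_sub; case: ifP => [kr|/negbT].
  by rewrite subdim_take // path_dim_left.
rewrite -ltnNge => rk; set l := ((size t.1).*2.+1 - k)%N.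
have lr : (l <= size t.1)%N by rewrite /l -addnn; lia.
have := path_dim_right sg i lr; rewrite weight_t -(subdim_perp sdm (U l) i).
by rewrite subdim_take // /l subKn // => /addIn.
Qed.

End PathSubreps.

Lemma stratum_path_subreps (K : fieldType) (Q : quiver)
    (sg : quiver_involution Q) (D : duality_structure sg) (theta : stability Q)
    (b : forall e : dimvec Q, bform K e) (e : dimvec Q) (t : hn_data Q)
    (m : rep K e) k :
    hn_weight sg t = e -> HN_stratum D theta b t m ->
    (k <= (size t.1).*2.+1)%N ->
  has_subrep (path_dim sg t k) m.
Proof.
move=> wt [sdm [U [[U0 subU leU _ _] dimU _]]] kn.
have sub' k' : (k' <= size t.1)%N -> is_subrep m (U k') by move=> /subU[].
have le' k' : (k' < size t.1)%N -> sub_le (U k') (U k'.+1) by move=> /leU[].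
exists (path_sub (b e) t U k); split; first exact: (path_sub_subrep sdm).
exact: (subdim_path_sub sdm).
Qed.

Section Polygons.
Variables (R : realFieldType) (Q : quiver) (sg : quiver_involution Q).
Variable theta : stability Q.

(** The line of slope mu through an end point of the segment of t' supports P(t)
    from above, because a segment of P(t) does not rise above a line that is
    above its end points. *)
Lemma hn_le_supporting (t t' : hn_data Q) :
    (forall k', (k' < size (hn_path sg t'))%N -> exists mu : rat,
      forall k, (k <= size (hn_path sg t))%N ->
        defect theta mu (path_dim sg t k) <=
          defect theta mu (path_dim sg t' k') /\
        defect theta mu (path_dim sg t k) <=
          defect theta mu (path_dim sg t' k'.+1)) ->
  hn_le R theta sg t t'.
Proof.
move=> supp x y y' [k [s [kt /andP[s0 s1] [xE yE]]]].
move=> [k' [s' [k't /andP[s'0 s'1] [xE' yE']]]].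
have [mu maxmu] := supp k' k't.
pose M : R := ratr mu; pose v u j := vertex R theta (hn_path sg u) j.
pose h u j := (v u j).2 - M * (v u j).1.
have hE u j : h u j = ratr (defect theta mu (path_dim sg u j)).
  by rewrite /h /v /vertex /= rmorphB rmorphM /= ratr_int ratr_nat.
have lth j : (j <= size (hn_path sg t))%N -> h t j <= h t' k' /\
  h t j <= h t' k'.+1.
  by move=> /maxmu[]; rewrite !hE !ler_rat.
have [l1 l2] := lth k (ltnW kt); have [l3 l4] := lth k.+1 kt.
have low : y - M * x <= Num.min (h t' k') (h t' k'.+1).
  have -> : y - M * x = (1 - s) * h t k + s * h t k.+1.
    by rewrite xE yE /h /v /vertex /=; ring.
  by rewrite le_min; apply/andP; split; nra.
have high : Num.min (h t' k') (h t' k'.+1) <= y' - M * x.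
  have -> : y' - M * x = (1 - s') * h t' k' + s' * h t' k'.+1.
    by rewrite xE' yE' /h /v /vertex /=; ring.
  by have [le|lt] := leP (h t' k') (h t' k'.+1); nra.
by have := le_trans low high; lra.
Qed.

End Polygons.

Lemma size_hn_path (Q : quiver) (sg : quiver_involution Q) (t : hn_data Q) :
  size (hn_path sg t) = (size t.1).*2.+1.
Proof. by rewrite /hn_path size_cat /= size_rev size_map addnS addnn. Qed.

(** * Existence of the type and comparison of the polygons *)

Section HNType.
Variables (K : numClosedFieldType) (Q : quiver) (sg : quiver_involution Q).
Variables (D : duality_structure sg) (theta : stability Q).
Hypothesis htheta : sigma_compatible sg theta.
Variable b : forall e : dimvec Q, bform K e.
Hypothesis hb : forall e : dimvec Q, sd_dimvec D e -> selfdual_form D (b e).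
Variables (e : dimvec Q) (m : rep K e).
Hypotheses (he : sd_dimvec D e) (sdm : selfdual_rep D (b e) m).

(** The type is read off the hull. The subrepresentations between U_k and
    U_(k+1) give no point above the hull, so the subquotients are semistable;
    the same holds for those between U_r and its orthogonal with slope 0. In the
    left half of the path a segment is an edge of the hull, in the right half
    the dual of an edge, and the middle segment from U_r to its orthogonal has
    mu = 0. *)
Lemma exists_HN_stratum : exists t : hn_data Q,
  [/\ HN_sigma D theta b e t, HN_stratum D theta b t m &
    forall k, (k < size (hn_path sg t))%N -> exists mu : rat,
      forall W, is_subrep m W ->
        defect theta mu (subdim W) <= defect theta mu (path_dim sg t k) /\
        defect theta mu (subdim W) <= defect theta mu (path_dim sg t k.+1)].
Proof.
have [r [U [mu [U0 subU edgeU decmu [maxr minr]]]]] :=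
  exists_HN_filtration theta m.
have subr := subU r (leqnn r).
have isor := maximal_isotropic htheta sdm subr maxr minr.
have leUr k : (k <= r)%N -> sub_le (U k) (U r).
  move=> /subnKC; move: (r - k)%N => n; elim: n k => [|n IHn] k kE.
    by move: kE; rewrite addn0 => -> i.
  have kr : (k < r)%N by lia.
  have [leU _ _ _ _] := edgeU k kr; move=> i; apply: submx_trans (leU i) _.
  by apply: IHn; lia.
have isoU k : (k <= r)%N -> isotropic (b e) (U k).
  move=> kr; apply/isotropicP => i; apply: submx_trans (leUr k kr i) _.
  have /isotropicP/(_ i) := isor => /submx_trans; apply.
  exact: (sub_le_perp (b e) (leUr k kr)).
pose dk k := subquotdim (U k.+1) (U k); pose einf := sdquotdim (b e) (U r).
have dkE k nu : (k < r)%N -> defect theta nu (subdim (U k.+1)) =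
    defect theta nu (dk k) + defect theta nu (subdim (U k)).
  move=> kr; have [leU _ _ _ _] := edgeU k kr.
  by apply: defectD => i; rewrite subquotdimE.
have dk_gt0 k : (k < r)%N -> (0 < dimtot (dk k))%N.
  move=> kr; have [leU ltU _ _ _] := edgeU k kr; move: ltU.
  by rewrite (dimtotD (fun i => esym (subquotdimE leU i))) -/(dk k); lia.
have slope_dk k : (k < r)%N -> slope theta (dk k) = mu k.
  move=> kr; apply: slope_eq; first exact: dk_gt0.
  have [_ _ _ max1 max2] := edgeU k kr; have := dkE k (mu k) kr.
  by have := max1 _ (subU _ kr); have := max2 _ (subU _ (ltnW kr)); lra.
have ss_dk k : (k < r)%N -> semistable theta (subquot_rep m (U k.+1) (U k)).
  move=> kr X subX [i nzX]; have [leU _ _ max1 _] := edgeU k kr.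
  rewrite [X in _ <= X]slope_dk // slope_le; last first.
    by apply: (@dimtot_gt0 _ _ i); rewrite /subdim mxrank_eq0.
  have := max1 _ (pull_subquot_subrep leU (subU _ (ltnW kr)) (subU _ kr) subX).
  by rewrite (defectD _ _ (pull_subquot_dim leU X)); lra.
have isoP : sub_le (U r) (perp (b e) (U r)) by apply/isotropicP.
have ss_inf : sigma_semistable theta (sdquot_form (b e) (U r))
  (sdquot_rep (b e) m (U r)).
  move=> X subX _ [i nzX]; rewrite slope_le; last first.
    by apply: (@dimtot_gt0 _ _ i); rewrite /subdim mxrank_eq0.
  have := maxr _ (pull_subquot_subrep isoP subr (perp_subrep sdm subr) subX).
  by rewrite (defectD _ _ (pull_subquot_dim isoP X)); lra.
have sorted_mu : sorted >%R (rcons [seq slope theta (dk k) | k <- iota 0 r] 0).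
  apply: sorted_gt_rcons0 => k kr; first by rewrite slope_dk //;
    case: (edgeU k kr).
  by rewrite !slope_dk ?(ltnW kr) ?decmu.
pose dv k : dimvec Q := [ffun i => dk k i].
pose t : hn_data Q := ([seq dv k | k <- iota 0 r], [ffun i => einf i]).
have size_t : size t.1 = r by rewrite size_map size_iota.
have nth_t k : (k < r)%N -> nth [ffun=> 0%N] t.1 k = dv k.
  by move=> kr; rewrite (nth_map 0%N) ?size_iota // nth_iota.
have einfE i : (einf i + (subdim (U r) i + subdim (U r) (iv sg i)))%N = e i.
  exact: (sdquotdimE sdm isor).
have dimU k : (k < size t.1)%N ->
  subquotdim (U k.+1) (U k) =1 nth [ffun=> 0%N] t.1 k.
  by rewrite size_t => kr i; rewrite nth_t // ffunE.
have leU k : (k < size t.1)%N -> sub_le (U k) (U k.+1).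
  by rewrite size_t => /edgeU[].
have sumU i : subdim (U r) i = (\sum_(d <- t.1) (d : dimvec Q) i)%N.
  by rewrite -{1}size_t (subdim_take U0 leU dimU) // take_size.
have wt : hn_weight sg t = e.
  apply/ffunP => i; rewrite ffunE big_split /= -sumU ffunE -(einfE i).
  rewrite (eq_bigr (fun d : dimvec Q => d (iv sg i))); last by move=> d _;
    rewrite ffunE.
  by rewrite -sumU addnC.
have sd_einf : sd_dimvec D t.2.
  have [e_iv e_even] := he; split=> i; rewrite /= !ffunE.
    have := einfE (iv sg i); have := einfE i; rewrite iv_involutive e_iv; lia.
  move=> iv_i ds_i; have := e_even i iv_i ds_i; rewrite -(einfE i) iv_i addnn.
  by rewrite oddD odd_double addbF.
exists t; split.
- split=> //; split=> //.
  + move=> d /mapP[k]; rewrite mem_iota add0n /= => kr ->; split.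
      have := dk_gt0 k kr; rewrite lt0n => nz; apply: contrapT => noi.
      move: nz; rewrite /dimtot big1 // => i _; apply/eqP/negPn/negP => nzi.
      by apply: noi; exists i; rewrite ffunE.
    by apply: semistable_eq_dim (ss_dk k kr) => i; rewrite ffunE.
  + rewrite -map_comp (eq_map (g := fun k => slope theta (dk k))) // => k.
    by apply: eq_slope => i; rewrite ffunE.
  have := hb sd_einf; have := sdquot_selfdual sdm subr isor.
  move: ss_inf; move: (sdquot_form _ _) (sdquot_rep _ _ _) (b t.2).
  have : sdquotdim (b e) (U r) = t.2 :> (vert Q -> nat).
    by apply: funext => i; rewrite ffunE.
  move=> E; case: _ / E => c n b' ssn sdn sdb'.
  exact: isometry_transport ssn.
- split=> //; exists U; split=> //; rewrite size_t.
    split=> // [k kr|k kr|]; last by right.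
      by split; [apply: subU|apply: isoU].
    by split; [apply: leU; rewrite size_t|apply: ss_dk].
  by move=> i; rewrite ffunE.
have subU' k : (k <= size t.1)%N -> is_subrep m (U k) by rewrite size_t;
  apply: subU.
have pathE k : (k <= (size t.1).*2.+1)%N ->
    subdim (path_sub (b e) t U k) =1 path_dim sg t k.
  exact: (subdim_path_sub sdm).
move=> k; rewrite size_hn_path => kn.
suff [nu [max1 max2]] : exists nu,
  theta_maximal theta m nu (path_sub (b e) t U k) /\
    theta_maximal theta m nu (path_sub (b e) t U k.+1).
  exists nu => W subW; rewrite -!(eq_defect _ _ (pathE _ _)) ?(ltnW kn) //.
  by split; [apply: max1|apply: max2].
rewrite /path_sub size_t; rewrite size_t in kn; case: (ltngtP k r) =>
  [kr|rk|->].
- by have [_ _ _ max1 max2] := edgeU k kr; exists (mu k).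
- have [l lr [-> ->]] : exists2 l, (l < r)%N &
  (r.*2.+1 - k = l.+1 /\ r.*2.+1 - k.+1 = l)%N.
    by exists (r.*2 - k)%N; move: kn; rewrite -addnn; [|split]; lia.
  have [_ _ _ max1 max2] := edgeU l lr; exists (- mu l).
  by split; apply: (theta_maximal_perp htheta sdm).
exists 0; rewrite (_ : r.*2.+1 - r.+1 = r)%N; last by rewrite -addnn; lia.
by split=> //; rewrite -[X in theta_maximal _ _ X]oppr0;
  apply: (theta_maximal_perp htheta sdm).
Qed.

End HNType.

Lemma stratum_closure (K : numClosedFieldType) (R : realFieldType) (Q : quiver)
    (sg : quiver_involution Q) (D : duality_structure sg) (theta : stability Q)
    (htheta : sigma_compatible sg theta) (b : forall e : dimvec Q, bform K e)
    (hb : forall e : dimvec Q, sd_dimvec D e -> selfdual_form D (b e))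
    (e : dimvec Q) (he : sd_dimvec D e) (t : hn_data Q)
    (wt : hn_weight sg t = e) (m : rep K e) :
    zariski_closure_in (selfdual_rep D (b e)) (HN_stratum D theta b t) m ->
  exists t', [/\ HN_sigma D theta b e t', hn_le R theta sg t t'
    & HN_stratum D theta b t' m].
Proof.
move=> [sdm cl]; have [t' [ht' st' supp]] := exists_HN_stratum htheta hb he sdm.
exists t'; split=> //; apply: hn_le_supporting => k' k't.
have [mu maxmu] := supp k' k't; exists mu => k kt.
have [|W [subW dimW]] := cl _
  (@zariski_closed_has_subrep K Q e (path_dim sg t k)).
  by move=> m' st; apply: (stratum_path_subreps wt st);
    rewrite -(size_hn_path sg).
by rewrite -!(eq_defect _ _ dimW); apply: maxmu.
Qed.

Theorem proposition2p3 (R : realType) (Q : quiver) (sg : quiver_involution Q)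
    (D : duality_structure sg) (theta : stability Q)
    (htheta : sigma_compatible sg theta)
    (b : forall e : dimvec Q, bform R[i] e)
    (hb : forall e : dimvec Q, sd_dimvec D e -> selfdual_form D (b e))
    (e : dimvec Q) (he : sd_dimvec D e)
    (t : hn_data Q) (ht : HN_sigma D theta b e t) :
  forall m : rep R[i] e,
    zariski_closure_in (selfdual_rep D (b e)) (HN_stratum D theta b t) m ->
    exists t' : hn_data Q,
      [/\ HN_sigma D theta b e t', hn_le R theta sg t t'
        & HN_stratum D theta b t' m].
Proof.
by move=> m; apply: stratum_closure => //; case: ht.
Qed.
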